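(* Suppose $X$ is sub-Gaussian with constant $C_1$. There is a constant $C>0$ depending only on $C_1$ such that for all indices $s\in\{1,\dots,d\}$ with $$\frac{\lambda_s}{\lambda_s-\lambda_{d+1}}\sum_{j\le s}\frac{\lambda_j}{\lambda_j-\lambda_{d+1}}\le\frac{n}{16C_3^2}$$ (in particular $\lambda_s>\lambda_{d+1}$) we have $$\mathbb E[R(\hat P_{\le d})]\le C\operatorname{tr}_{>s}(\Sigma)+C\operatorname{tr}(\Sigma)\exp\Big(-\frac{n(\lambda_s-\lambda_{d+1})^2}{(4C_3\lambda_s)^2}\Big).$$
   Context: Let $(\mathcal H,\langle\cdot,\cdot\rangle)$ be a separable real Hilbert space of dimension $p\in\mathbb N\cup\{+\infty\}$ with norm $\|\cdot\|$, and let $X$ be a centered $\mathcal H$-valued random variable with $\mathbb E\|X\|^2<\infty$. Its covariance operator is $\Sigma=\mathbb E[X\otimes X]$, where $(u\otimes v)x=\langle v,x\rangle u$. Its eigenvalues (with multiplicity) are $\lambda_1\ge\lambda_2\ge\dots>0$, with corresponding eigenvectors which are assumed to form an orthonormal basis of $\mathcal H$. Put $\operatorname{tr}_{>r}(\Sigma)=\sum_{j>r}\lambda_j$. Let $X_1,\dots,X_n$ be $n\ge1$ independent copies of $X$, $\hat\Sigma=\frac1n\sum_{i=1}^nX_i\otimes X_i$, with eigenvalues $\hat\lambda_1\ge\hat\lambda_2\ge\dots\ge0$ and an orthonormal basis of eigenvectors $\hat u_1,\hat u_2,\dots$; $\hat P_j=\hat u_j\otimes\hat u_j$, $\hat P_{\le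 d}=\sum_{j\le d}\hat P_j$. Here $d$ is an integer with $1\le d<p$; $\|\cdot\|_\infty$ is the operator norm. For an orthogonal projection $P$ of rank $d$ the reconstruction error is $R(P)=\operatorname{tr}(\Sigma(I-P))$ (which equals $\mathbb E\|X-PX\|^2$ for deterministic $P$); $R(\hat P_{\le d})$ is this function evaluated at the random projection $\hat P_{\le d}$. $X$ is sub-Gaussian with constant $C_1$ if $\mathbb E\|X\|^2<\infty$ and $\sup_{k\ge1}k^{-1/2}\mathbb E[|\langle X,u\rangle|^k]^{1/k}\le C_1\mathbb E[\langle X,u\rangle^2]^{1/2}$ for all $u\in\mathcal H$. $C_3>1$ is a constant depending only on $C_1$ such that for every centered sub-Gaussian random variable with constant $C_1$ in a separable Hilbert space, with covariance $\Sigma$, largest eigenvalue $\lambda_1$ of $\Sigma$, and sample covariance $\hat\Sigma$ from $n$ independent copies, one has $\mathbb P(\|\Sigma-\hat\Sigma\|_\infty>C_3\lambda_1x)\le e^{-n(x\wedge x^2)}$ whenever $x>0$ and $\operatorname{tr}(\Sigma)\le n\lambda_1(x\wedge x^2)$ (the existence of such $C_3$ is a known theorem of Koltchinskii and Lounici). *)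

(* Defs.v *)
From HB Require Import structures.
From mathcomp Require Import all_boot all_order all_algebra.
From mathcomp Require Import all_classical all_reals all_analysis.

Set Implicit Arguments.
Unset Strict Implicit.
Unset Printing Implicit Defensive.

Import Order.TTheory GRing.Theory Num.Theory.
Import numFieldNormedType.Exports.

Local Open Scope classical_set_scope.
Local Open Scope ring_scope.

HB.mixin Record isSeparableHilbert (R : realType) H
    of CompleteNormedModule R H := {
  inner : {dot H for @idfun R} ;
  sqr_normE : forall x : H, `|x| ^+ 2 = inner x x ;
  separable : exists2 D : set H, countable D & dense D
}.

#[short(type="separableHilbertType")]
HB.structure Definition SeparableHilbert (R : realType) :=
  {H of isSeparableHilbert R H & CompleteNormedModule R H}.

Notation borel H := (g_sigma_algebraType (@open H)).

(* A dimension in N \cup {+oo}: [Some m] is the finite dimension m and [None]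
   is +oo.  Bases, eigenvalues and eigenvectors are indexed from 1, by the j
   with [in_dim p j]; the values of such a family at other j are irrelevant. *)
Definition in_dim (p : option nat) (j : nat) : bool :=
  (0 < j)%N && (if p is Some m then (j <= m)%N else true).

Section operators.
Context {R : realType} {H : separableHilbertType R}.
Implicit Types (p : option nat) (A : H -> H) (e u : nat -> H).

Definition tensor (u v : H) : H -> H := fun x => inner v x *: u.

Definition bounded_operator A : Prop := linear A /\ continuous A.

Definition opnorm A : \bar R :=
  ereal_sup [set (`|A x|)%:E | x in [set x : H | `|x| <= 1]].

Definition orthonormal_basis p e : Prop :=
  (forall i j, in_dim p i -> in_dim p j -> inner (e i) (e j) = (i == j)%:R) /\
  (forall x : H,
     (fun N => \sum_(1 <= j < N.+1 | in_dim p j) inner x (e j) *: e j) @ \oo --> x).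

(* The trace computed in the orthonormal basis e; for trace class operators
   (and for all positive ones) it does not depend on e. *)
Definition trace p e A : \bar R :=
  (\sum_(1 <= j <oo | in_dim p j) (inner (A (e j)) (e j))%:E)%E.

Definition is_eigenvalue A (l : R) : Prop :=
  exists2 v : H, v != 0 & A v = l *: v.

Definition is_largest_eigenvalue A (l : R) : Prop :=
  is_eigenvalue A l /\ forall m, is_eigenvalue A m -> m <= l.

Definition eigendecomposition p A (lam : nat -> R) u : Prop :=
  [/\ orthonormal_basis p u,
      forall j, in_dim p j -> A (u j) = lam j *: u j
    & forall i j, in_dim p i -> in_dim p j -> (i <= j)%N -> lam j <= lam i].

(* \hat P_{<= d} when u is the family of the \hat u_j. *)
Definition eigenprojection u (d : nat) : H -> H :=
  fun x => \sum_(1 <= j < d.+1) tensor (u j) (u j) x.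

(* tr(A (I - Q)), computed in the orthonormal basis e. *)
Definition reconstruction_error p e A (Q : H -> H) : \bar R :=
  trace p e (fun x => A (x - Q x)).

End operators.

Definition trace_gt {R : realType} (p : option nat) (lam : nat -> R) (r : nat) :
    \bar R :=
  (\sum_(r.+1 <= j <oo | in_dim p j) (lam j)%:E)%E.

Section random_vectors.
Context {R : realType} {H : separableHilbertType R}.
Context {d : measure_display} {T : measurableType d} (P : probability T R).
Implicit Types (X : T -> H) (S : H -> H).

Definition random_vector X : Prop :=
  measurable_fun [set: T] (X : T -> borel H).

(* Expectations of vectors and operators are taken in the weak sense; for X
   with E|X|^2 < +oo they agree with the Bochner ones. *)
Definition centered X : Prop :=
  forall u : H, ('E_P[fun w => inner (X w) u] = 0)%E.

Definition finite_second_moment X : Prop :=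
  ('E_P[fun w => (`|X w| ^+ 2)%R] < +oo)%E.

Definition is_operator_expectation (A : T -> H -> H) S : Prop :=
  bounded_operator S /\
  forall u v : H, ('E_P[fun w => inner (A w u) v] = (inner (S u) v)%:E)%E.

Definition is_covariance X S : Prop :=
  is_operator_expectation (fun w => tensor (X w) (X w)) S.

Definition subgaussian (C1 : R) X : Prop :=
  finite_second_moment X /\
  forall u : H,
    (ereal_sup
       [set (k%:R `^ (- 2^-1))%:E *
            'E_P[fun w => (`|inner (X w) u| ^+ k)%R] `^ (k%:R^-1)
       | k in [set k : nat | (1 <= k)%N]]
     <= C1%:E * 'E_P[fun w => (inner (X w) u ^+ 2)%R] `^ (2^-1))%E.

Definition independent_copies n X (Xs : 'I_n -> T -> H) : Prop :=
  [/\ forall i, random_vector (Xs i),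
      forall i (B : set (borel H)), measurable B ->
        P (Xs i @^-1` B) = P (X @^-1` B)
    & forall B : 'I_n -> set (borel H), (forall i, measurable (B i)) ->
        P (\bigcap_(i in [set: 'I_n]) Xs i @^-1` B i)
        = (\prod_(i < n) P (Xs i @^-1` B i))%E].

Definition sample_covariance n (Xs : 'I_n -> T -> H) (w : T) : H -> H :=
  fun x => n%:R^-1 *: \sum_(i < n) tensor (Xs i w) (Xs i w) x.

End random_vectors.

(* C3 is admissible in the Koltchinskii-Lounici concentration inequality for
   sub-Gaussian variables with constant C1, uniformly over all separable
   Hilbert spaces, probability spaces and sample sizes. *)
Definition koltchinskii_lounici {R : realType} (C1 C3 : R) : Prop :=
  forall (H : separableHilbertType R) (d : measure_display)
    (T : measurableType d) (P : probability T R)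
    (p : option nat) (e : nat -> H) (X : T -> H) (Sigma : H -> H)
    (n : nat) (Xs : 'I_n -> T -> H) (lam1 x : R),
  orthonormal_basis p e ->
  random_vector X -> centered P X -> subgaussian P C1 X ->
  is_covariance P X Sigma -> is_largest_eigenvalue Sigma lam1 ->
  (1 <= n)%N -> independent_copies P X Xs ->
  0 < x ->
  (trace p e Sigma <= (n%:R * lam1 * Num.min x (x ^+ 2))%:E)%E ->
  (P [set w | ((C3 * lam1 * x)%:E
               < opnorm (fun v => (Sigma v - sample_covariance Xs w v)%R))%E]
   <= (expR (- (n%:R * Num.min x (x ^+ 2))))%:E)%E.

(* Main.v *)
(** Write mu = lam_{d+1}, g_j = lam_j - mu, Delta = Sigma - hat Sigma, and
    P_{<=s}, P_{>s} for the spectral projections of Sigma.  As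
    R(hat P) = sum_j lam_j |(I - hat P) u_j|^2, the terms j > s cost at most
    tr_{>s}, and the other ones at most (lam_s / g_s) G, where
    G = sum_{j <= s} g_j |(I - hat P) u_j|^2.
    If hat lam_{d+1} <= mu + g_s / 2, then for k > d the identity
    (lam_j - hat lam_k) <u_j, hat u_k> = <Delta u_j, hat u_k> bounds G by
    <Delta u_j, hat u_k>^2 / g_j summed over j <= s and k > d.  Splitting
    hat u_k along P_{<=s} and P_{>s}, the first part is at most
    |A Delta A|^2 G with A = sum_{j <= s} g_j^{-1/2} u_j (x) u_j, hence is
    absorbed as soon as |A Delta A| <= 1/4, and the second part has expectation
    of order sum_{j <= s} (lam_j / g_j) tr_{>s} / n by a variance computation.
    Both events come from the Koltchinskii-Lounici inequality, applied to
    P_{>d} X and to A X.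

    For P_{>d} X that inequality needs tr_{>d} <= n mu min(x, x^2) with
    x = g_s / (2 C3 mu), which may fail.  One then replaces s by the largest
    r <= s for which it holds: its failure at r + 1, together with the
    hypothesis on s, gives sum_{r < j <= s} lam_j <= tr_{>d}, so that
    tr_{>r} <= 2 tr_{>s}. *)

Require Import Defs.
From HB Require Import structures.
From mathcomp Require Import all_boot all_order all_algebra.
From mathcomp Require Import all_classical all_reals all_analysis.
From mathcomp Require Import measurable_realfun ring lra.

Set Implicit Arguments.
Unset Strict Implicit.
Unset Printing Implicit Defensive.

Import Order.TTheory GRing.Theory Num.Theory.
Import numFieldNormedType.Exports.

Local Open Scope classical_set_scope.
Local Open Scope ring_scope.

(** * Hilbert space geometry *)

Section inner_product.
Context {R : realType} {H : separableHilbertType R}.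
Implicit Types (x y z : H) (a : R).

Lemma innerDl x y z : inner (x + y) z = inner x z + inner y z.
Proof. exact: linearDl. Qed.

Lemma innerDr x y z : inner z (x + y) = inner z x + inner z y.
Proof. exact: linearDr. Qed.

Lemma innerZl a x z : inner (a *: x) z = a * inner x z.
Proof. exact: linearZl_LR. Qed.

Lemma innerC x y : inner x y = inner y x.
Proof. by rewrite hermC expr0 mul1r. Qed.

Lemma innerZr a x z : inner z (a *: x) = a * inner z x.
Proof. by rewrite innerC innerZl innerC. Qed.

Lemma inner0l x : inner 0 x = 0 :> R.
Proof. exact: linear0l. Qed.

Lemma inner0r x : inner x 0 = 0 :> R.
Proof. by rewrite innerC inner0l. Qed.

Lemma innerNl x z : inner (- x) z = - inner x z.
Proof. by rewrite -scaleN1r innerZl mulN1r. Qed.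

Lemma innerNr x z : inner z (- x) = - inner z x.
Proof. by rewrite innerC innerNl innerC. Qed.

Lemma innerBl x y z : inner (x - y) z = inner x z - inner y z.
Proof. by rewrite innerDl innerNl. Qed.

Lemma innerBr x y z : inner z (x - y) = inner z x - inner z y.
Proof. by rewrite innerDr innerNr. Qed.

Lemma inner_suml I (r : seq I) (Q : pred I) (F : I -> H) z :
  inner (\sum_(i <- r | Q i) F i) z = \sum_(i <- r | Q i) inner (F i) z.
Proof.
apply: (big_morph (fun x => inner x z)) => [x y|]; [exact: innerDl|exact: inner0l].
Qed.

Lemma inner_sumr I (r : seq I) (Q : pred I) (F : I -> H) z :
  inner z (\sum_(i <- r | Q i) F i) = \sum_(i <- r | Q i) inner z (F i).
Proof. by rewrite innerC inner_suml; apply: eq_bigr => i _; rewrite innerC. Qed.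

Lemma inner_ge0 x : 0 <= inner x x :> R.
Proof. by rewrite -sqr_normE exprn_ge0. Qed.

(** Cauchy-Schwarz: expanding the squared norm of [inner y y *: x - inner x y *: y] gives
    [inner y y] times the difference of the two sides. *)
Lemma inner_sq_le x y : inner x y ^+ 2 <= inner x x * inner y y.
Proof.
have [->|y0] := eqVneq y 0; first by rewrite !inner0r mulr0 expr2 mulr0.
have yy : 0 < inner y y by rewrite -sqr_normE exprn_gt0 // normr_gt0.
have := inner_ge0 (inner y y *: x - inner x y *: y).
rewrite innerBl !innerBr !innerZl !innerZr (innerC y x).
set a := inner x x; set b := inner x y; set c := inner y y in yy *.
rewrite (_ : _ - _ = c * (a * c - b ^+ 2)); last by ring.
by rewrite pmulr_rge0 // subr_ge0.
Qed.

Lemma inner_abs_le x y : `|inner x y| <= `|x| * `|y|.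
Proof.
rewrite -(@ler_pXn2r _ 2) ?nnegrE ?mulr_ge0 //.
by rewrite exprMn !sqr_normE real_normK ?num_real // inner_sq_le.
Qed.

Lemma inner_continuousl y : continuous (fun x => inner x y : R).
Proof.
move=> x; apply/cvgrPdist_le => /= e e0.
(* The added 1 keeps the divisor positive when [y = 0]. *)
have k0 : 0 < `|y| + 1 by rewrite ltr_wpDl.
near=> z.
rewrite -innerBl (le_trans (inner_abs_le _ _)) //.
have : `|x - z| <= e / (`|y| + 1).
  near: z; apply: cvgr_dist_le; first exact: cvg_id.
  by rewrite divr_gt0.
rewrite ler_pdivlMr // => h; apply: le_trans h.
by rewrite ler_wpM2l // lerDl.
Unshelve. all: by end_near. Qed.

Lemma inner_continuousr y : continuous (fun x => inner y x : R).
Proof.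
rewrite (_ : (fun x => _) = (fun x => inner x y)); first exact: inner_continuousl.
by apply/funext => x; rewrite innerC.
Qed.

Lemma inner_eq0 x : inner x x = 0 :> R -> x = 0.
Proof.
by move/eqP; rewrite -sqr_normE sqrf_eq0 normr_eq0 => /eqP.
Qed.

End inner_product.

Lemma in_dim_le p i j : (0 < i <= j)%N -> in_dim p j -> in_dim p i.
Proof.
move=> /andP[i0 ij] /andP[_]; rewrite /in_dim i0 /=; case: p => // m.
exact: leq_trans.
Qed.

(** The guard is vacuous below an index of the dimension; this mediates between plain finite sums
    and the guarded sums that come from series. *)
Lemma big_in_dim (V : nmodType) p (m d : nat) (F : nat -> V) : in_dim p d ->
  \sum_(m.+1 <= j < d.+1) F j = \sum_(m.+1 <= j < d.+1 | in_dim p j) F j.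
Proof.
move=> pd; rewrite [LHS]big_nat_cond [RHS]big_nat_cond; apply: eq_bigl => j.
case: (boolP (m < j < d.+1)%N) => //= /andP[mj jd].
by rewrite (in_dim_le _ pd) // (leq_ltn_trans _ mj).
Qed.

(** * Parseval, Bessel and projections onto leading basis vectors *)

Section orthonormal_bases.
Context {R : realType} {H : separableHilbertType R}.
Variables (p : option nat) (e : nat -> H).
Hypothesis onb : orthonormal_basis p e.
Implicit Types (x y z : H) (a : R).

Lemma onb_inner i j : in_dim p i -> in_dim p j ->
  inner (e i) (e j) = (i == j)%:R :> R.
Proof. by case: onb => + _; apply. Qed.

(** The continuous functional [inner _ y] is applied to the expansion of [x]. *)
Lemma parseval x y :
  (fun N => \sum_(1 <= j < N.+1 | in_dim p j) inner x (e j) * inner y (e j))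
    @ \oo --> (inner x y : R).
Proof.
have [_ /(_ x) xe] := onb.
rewrite (_ : (fun N => _) = (fun z => inner z y) \o
  (fun N => \sum_(1 <= j < N.+1 | in_dim p j) inner x (e j) *: e j)).
  apply: continuous_cvg xe; exact: inner_continuousl.
apply/funext => N /=; rewrite inner_suml; apply: eq_bigr => j _.
by rewrite innerZl (innerC y).
Qed.

Lemma parseval_sq x :
  (fun N => \sum_(1 <= j < N.+1 | in_dim p j) inner x (e j) ^+ 2)
    @ \oo --> (inner x x : R).
Proof. exact: parseval. Qed.

(** The Parseval partial sums increase to their limit; discarding the first [m] squares only lowers
    them. *)
Lemma bessel x m N :
  \sum_(m.+1 <= j < N.+1 | in_dim p j) inner x (e j) ^+ 2 <= inner x x :> R.
Proof.
have H0 : nondecreasing_seq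
    (fun N => \sum_(1 <= j < N.+1 | in_dim p j) inner x (e j) ^+ 2 : R).
  apply/nondecreasing_seqP => k.
  rewrite big_mkcond [leRHS]big_mkcond [leRHS]big_nat_recr //= lerDl.
  by case: ifP => // _; rewrite sqr_ge0.
have := nondecreasing_cvgn_le H0 (cvgP _ (@parseval_sq x)) N.
rewrite (cvg_lim _ (@parseval_sq x)) //; apply: le_trans.
have [mN|Nm] := leqP m N; last first.
  by rewrite [leLHS]big_geq 1?ltnW // sumr_ge0 // => j _; rewrite sqr_ge0.
rewrite [leRHS](@big_cat_nat _ _ _ m.+1) //= lerDr.
by rewrite sumr_ge0 // => j _; rewrite sqr_ge0.
Qed.

Lemma onb_eq0 x : (forall j, in_dim p j -> inner x (e j) = 0 :> R) -> x = 0.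
Proof.
move=> x0; apply: inner_eq0; apply/esym.
have := @parseval_sq x; under eq_fun => N.
  by rewrite big1; [over|move=> j /x0 ->; rewrite expr0n].
by move=> /cvg_lim <- //; rewrite lim_cst.
Qed.

Lemma eigenprojection_onb d x j : in_dim p d -> in_dim p j ->
  inner (eigenprojection e d x) (e j) =
    (if (j <= d)%N then inner x (e j) else 0) :> R.
Proof.
move=> pd pj; rewrite /eigenprojection inner_suml.
rewrite (eq_big_nat _ _ (F2 := fun i => if i == j then inner x (e j) else 0)).
  by rewrite -big_mkcond big_nat1_eq ltnS; case/andP: pj => ->.
move=> i /andP[i1 id]; rewrite /tensor innerZl onb_inner //; last first.
  by apply: in_dim_le pd; rewrite i1.
by case: eqVneq => [->|_]; rewrite ?mulr1 ?mulr0 // innerC.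
Qed.

Lemma eigenprojection_cat d x : in_dim p d ->
  forall N, (d <= N)%N ->
  \sum_(1 <= j < N.+1 | in_dim p j) inner x (e j) ^+ 2 =
  inner (eigenprojection e d x) x +
  \sum_(d.+1 <= j < N.+1 | in_dim p j) inner x (e j) ^+ 2 :> R.
Proof.
move=> pd N dN; rewrite (@big_cat_nat _ _ _ d.+1) //=; congr (_ + _).
rewrite -(big_in_dim _ _ pd) /eigenprojection inner_suml; apply: eq_bigr => j _.
by rewrite /tensor innerZl (innerC x) expr2.
Qed.

(** Parseval with the first [d] squares subtracted. The splitting requires [d <= N], so the two
    sequences agree only eventually. *)
Lemma residual_cvg d x : in_dim p d ->
  (fun N => \sum_(d.+1 <= j < N.+1 | in_dim p j) inner x (e j) ^+ 2)
    @ \oo --> (inner (x - eigenprojection e d x) x : R).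
Proof.
move=> pd; rewrite innerBl.
have h : (fun N => \sum_(1 <= j < N.+1 | in_dim p j) inner x (e j) ^+ 2 -
    inner (eigenprojection e d x) x) @ \oo -->
    (inner x x - inner (eigenprojection e d x) x : R).
  by apply: cvgB; [exact: parseval_sq|exact: cvg_cst].
apply: cvg_trans h; apply: near_eq_cvg; near=> N.
rewrite (eigenprojection_cat x pd) 1?[X in X - _]addrC ?addrK //.
by near: N; exact: nbhs_infty_ge.
Unshelve. all: by end_near. Qed.

Lemma eigenprojection_sq d x :
  inner (eigenprojection e d x) x = \sum_(1 <= j < d.+1) inner x (e j) ^+ 2 :> R.
Proof.
rewrite /eigenprojection inner_suml; apply: eq_bigr => j _.
by rewrite /tensor innerZl (innerC x) expr2.
Qed.

Lemma residual_ge0 d x : in_dim p d ->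
  0 <= inner (x - eigenprojection e d x) x :> R.
Proof.
move=> pd; rewrite innerBl subr_ge0 eigenprojection_sq (big_in_dim _ _ pd).
exact: bessel.
Qed.

Lemma residual_le d x :
  inner (x - eigenprojection e d x) x <= inner x x :> R.
Proof.
rewrite innerBl lerBlDr lerDl eigenprojection_sq.
by rewrite sumr_ge0 // => j _; rewrite sqr_ge0.
Qed.

End orthonormal_bases.

(** * Bounded and self-adjoint operators *)

Section operators.
Context {R : realType} {H : separableHilbertType R}.
Implicit Types (A B : H -> H) (x y z : H) (a : R).

Definition self_adjoint A := forall x y, inner (A x) y = inner x (A y) :> R.

Lemma linear_funD A x y : linear A -> A (x + y) = A x + A y.
Proof. by move=> /(_ 1 x y); rewrite !scale1r. Qed.

Lemma linear_fun0 A : linear A -> A 0 = 0.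
Proof. by move=> lA; apply/(addrI (A 0)); rewrite -linear_funD // !addr0. Qed.

Lemma linear_funZ A a x : linear A -> A (a *: x) = a *: A x.
Proof. by move=> lA; rewrite -[a *: x]addr0 lA linear_fun0 // addr0. Qed.

Lemma linear_funB A x y : linear A -> A (x - y) = A x - A y.
Proof. by move=> lA; rewrite -scaleN1r linear_funD // linear_funZ // scaleN1r. Qed.

Lemma linear_fun_sum A I (r : seq I) (Q : pred I) (F : I -> H) : linear A ->
  A (\sum_(i <- r | Q i) F i) = \sum_(i <- r | Q i) A (F i).
Proof.
move=> lA; apply: (big_morph A) => [x y|]; [exact: linear_funD|exact: linear_fun0].
Qed.

Lemma bounded_operator_id : bounded_operator (@idfun H).
Proof. by split=> // x; exact: cvg_id. Qed.

Lemma bounded_operatorB A B : bounded_operator A -> bounded_operator B ->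
  bounded_operator (fun x => A x - B x).
Proof.
move=> [lA cA] [lB cB]; split=> [a x y|x].
  by rewrite lA lB scalerBr opprD !addrA; congr (_ + _); rewrite addrAC.
exact: (cvgB (cA x) (cB x)).
Qed.

Lemma bounded_operator_comp A B : bounded_operator A -> bounded_operator B ->
  bounded_operator (A \o B).
Proof.
move=> [lA cA] [lB cB]; split=> [a x y|x] /=; first by rewrite lB lA.
exact: (continuous_comp (cB x) (cA _)).
Qed.

Lemma bounded_operatorZ a A : bounded_operator A ->
  bounded_operator (fun x => a *: A x).
Proof.
move=> [lA cA]; split=> [b x y|x].
  by rewrite lA scalerDr !scalerA mulrC.
apply: cvgZr; exact: cA.
Qed.

Lemma bounded_operator_sum I (r : seq I) (A : I -> H -> H) :
  (forall i, bounded_operator (A i)) ->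
  bounded_operator (fun x => \sum_(i <- r) A i x).
Proof.
move=> bA; split=> [a x y|x].
  rewrite scaler_sumr -big_split; apply: eq_bigr => i _; exact: (bA i).1.
apply: cvg_big => [|i _]; [exact: add_continuous|exact: (bA i).2].
Qed.

Lemma bounded_operator_tensor x y : bounded_operator (tensor x y).
Proof.
split=> [a u v|u]; first by rewrite /tensor innerDr innerZr scalerDl scalerA.
apply: cvgZl; exact: inner_continuousr.
Qed.

Lemma tensor_adjoint x y u v : inner (tensor x y u) v = inner u (tensor y x v) :> R.
Proof. by rewrite /tensor innerZl innerZr mulrC (innerC u) innerC mulrC. Qed.

Lemma self_adjoint_sum I (r : seq I) (A : I -> H -> H) :
  (forall i, self_adjoint (A i)) -> self_adjoint (fun x => \sum_(i <- r) A i x).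
Proof.
by move=> sA x y; rewrite inner_suml inner_sumr; apply: eq_bigr => i _; exact: sA.
Qed.

Lemma bounded_operator_eigenprojection (e : nat -> H) d :
  bounded_operator (eigenprojection e d).
Proof. by apply: bounded_operator_sum => i; exact: bounded_operator_tensor. Qed.

Lemma self_adjoint_eigenprojection (e : nat -> H) d :
  self_adjoint (eigenprojection e d).
Proof. by apply: self_adjoint_sum => i x y; exact: tensor_adjoint. Qed.

End operators.

(** * Measurability *)

Section random_vectors.
Context {R : realType} {H : separableHilbertType R}.
Context {d : measure_display} {T : measurableType d}.

Lemma continuous_borel (H' : separableHilbertType R) (f : H -> H') : continuous f ->
  measurable_fun [set: borel H] (f : borel H -> borel H').
Proof.
move=> /continuousP cf.
apply: (@measurability _ _ (borel H) (borel H') _ _ (@open H')) => //.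
by move=> _ [B oB <-]; rewrite setTI; apply: sub_sigma_algebra; exact: cf.
Qed.

Lemma continuous_borel_real (f : H -> R) : continuous f ->
  measurable_fun [set: borel H] (f : borel H -> R).
Proof.
move=> /continuousP cf.
apply: (@measurability _ _ (borel H) R _ _ (@RGenOInfty.G R)).
  exact: RGenOInfty.measurableE.
move=> _ [_ [x ->] <-]; rewrite setTI; apply: sub_sigma_algebra; apply: cf.
exact: interval_open.
Qed.

Lemma random_vector_comp (A : H -> H) (X : T -> H) :
  continuous A -> random_vector X -> random_vector (A \o X).
Proof.
move=> cA mX; apply: (@measurable_comp _ _ _ _ _ _ [set: borel H]) => //.
exact: continuous_borel.
Qed.

Lemma measurable_real_comp (f : H -> R) (X : T -> H) :
  continuous f -> random_vector X -> measurable_fun setT (f \o X).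
Proof.
move=> cf mX; apply: (@measurable_comp _ _ _ _ _ _ [set: borel H]) => //.
exact: continuous_borel_real.
Qed.

Lemma measurable_inner (X : T -> H) v :
  random_vector X -> measurable_fun setT (fun w => inner (X w) v : R).
Proof. exact: measurable_real_comp (@inner_continuousl _ _ v). Qed.

(** Parseval makes the squared norm a pointwise limit of finite sums of squared coordinates, so weak
    measurability of [Y] is enough. *)
Lemma measurable_sqnorm p (e : nat -> H) (Y : T -> H) : orthonormal_basis p e ->
  (forall v, measurable_fun setT (fun w => inner (Y w) v : R)) ->
  measurable_fun setT (fun w => inner (Y w) (Y w) : R).
Proof.
move=> onb mY.
apply: (@measurable_fun_cvg _ _ _ _
  (fun N w => \sum_(1 <= j < N.+1 | in_dim p j) inner (Y w) (e j) ^+ 2)).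
  move=> N; under eq_fun do rewrite -big_filter.
  apply: measurable_sum => j; exact: measurable_funX.
by move=> w _; exact: (parseval_sq onb).
Qed.

(** A vector of the closed ball with image longer than [c] can be shrunk into the open ball without
    losing this property; both conditions are then open, so a point of [D] satisfies them too. *)
Lemma opnorm_gtP (A : H -> H) (D : set H) (c : R) : bounded_operator A ->
  dense D -> 0 <= c ->
  (c%:E < opnorm A)%E <-> exists2 x, D x & `|x| < 1 /\ c < `|A x|.
Proof.
move=> [lA cA] dD c0; split => [|[x Dx [x1 cAx]]]; last first.
  apply: (@lt_le_trans _ _ (`|A x|)%:E); first by rewrite lte_fin.
  by apply: ereal_sup_ubound; exists x => //=; exact: ltW.
move=> /ereal_sup_gt[_ /= [x x1 <-]]; rewrite lte_fin => cAx.
have Ax0 : 0 < `|A x| by exact: le_lt_trans cAx.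
(* With this factor the norm of [A (t *: x)] is the midpoint of [c] and the norm of [A x]. *)
pose t := (c + `|A x|) / (2 * `|A x|).
have t0 : 0 <= t by rewrite divr_ge0 // ?addr_ge0 // mulr_ge0.
have t1 : t < 1 by rewrite ltr_pdivrMr ?mulr_gt0 // mul1r; lra.
pose O := [set y : H | `|y| < 1] `&` [set y | c < `|A y|].
have [||z [[z1 cz] Dz]] := dD O; last by exists z.
  exists (t *: x); split => /=.
    rewrite normrZ ger0_norm //; apply: le_lt_trans t1.
    by rewrite ler_piMr.
  rewrite linear_funZ // normrZ ger0_norm // /t invfM mulrA divfK ?gt_eqF //.
  lra.
apply: openI.
  apply: (open_comp (f := fun y : H => `|y|) (D := [set r | r < 1])) => [y _|].
    exact: norm_continuous.
  exact: open_lt.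
apply: (open_comp (f := fun y : H => `|A y|) (D := [set r | c < r])) => [y _|].
  apply: (continuous_comp (cA y)); exact: norm_continuous.
exact: open_gt.
Qed.

(* The supremum defining the operator norm may be taken over a countable dense
   subset of the open unit ball. *)
Lemma measurable_opnorm_gt p (e : nat -> H) (A : T -> H -> H) (c : R) :
  orthonormal_basis p e ->
  (forall w, bounded_operator (A w)) ->
  (forall x v, measurable_fun setT (fun w => inner (A w x) v : R)) ->
  0 <= c ->
  measurable [set w | (c%:E < opnorm (A w))%E].
Proof.
move=> onb bA mA c0; have [D cD dD] := @separable R H.
pose E := D `&` [set x | `|x| < 1].
rewrite (_ : [set w | _] = \bigcup_(x in E) [set w | c ^+ 2 < inner (A w x) (A w x)]).
  rewrite bigcup_set_type; apply: countable_bigcupT_measurable => [|x].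
    rewrite (eq_countable (card_setT _)); apply: sub_countable cD.
    by apply: subset_card_le => x [].
  rewrite -[X in measurable X]setTI.
  have := @measurable_sqnorm _ e (fun w => A w (\val x)) onb (mA (\val x)).
  move=> /(_ measurableT `]c ^+ 2, +oo[%classic (measurable_itv _)).
  by congr measurable; apply/seteqP; split => w /=; rewrite in_itv /= andbT.
apply/seteqP; split => w /=.
  move/(opnorm_gtP (bA w) dD c0) => [x Dx [x1 cx]]; exists x => //=.
  by rewrite -sqr_normE ltr_pXn2r // nnegrE.
move=> [x [Dx x1]] /=; rewrite -sqr_normE ltr_pXn2r ?nnegrE // => cx.
by apply/(opnorm_gtP (bA w) dD c0); exists x.
Qed.

End random_vectors.

Lemma bounded_operator_bound {R : realType} {H : separableHilbertType R}
    (A : H -> H) : bounded_operator A ->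
  exists2 K : R, 0 <= K & forall x, `|A x| <= K * `|x|.
Proof.
move=> [lA cA].
pose f : {linear H -> H} := HB.pack A (GRing.isLinear.Build _ _ _ _ A lA).
have /linear_boundedP : bounded_near f (nbhs (0 : H)).
  by apply/linear_bounded_continuous.
move=> /pinfty_ex_gt0[K K0 h]; exists K => //; exact: ltW.
Qed.

(** * Covariance operators and linear images of the sample *)

Section covariance.
Context {R : realType} {H : separableHilbertType R}.
Context {d : measure_display} {T : measurableType d} (P : probability T R).
Implicit Types (X : T -> H) (S D : H -> H).

Lemma covariance_inner X S u v : is_covariance P X S ->
  ('E_P[fun w => (inner (X w) u * inner (X w) v)%R] = (inner (S u) v)%:E)%E.
Proof.
move=> [_ /(_ u v) <-]; congr ('E_P[_])%E.
by apply/funext => w; rewrite /tensor innerZl.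
Qed.

Lemma covariance_self_adjoint X S : is_covariance P X S -> self_adjoint S.
Proof.
move=> cS u v; rewrite (innerC u); apply: EFin_inj.
rewrite -!(covariance_inner _ _ cS); congr ('E_P[_])%E.
by apply/funext => w; rewrite mulrC.
Qed.

Lemma sample_covariance_inner n (Xs : 'I_n -> T -> H) w u v :
  inner (sample_covariance Xs w u) v =
  n%:R^-1 * \sum_(i < n) inner (Xs i w) u * inner (Xs i w) v.
Proof.
rewrite /sample_covariance innerZl inner_suml; congr (_ * _).
by apply: eq_bigr => i _; rewrite /tensor innerZl.
Qed.

Lemma bounded_operator_sample_covariance n (Xs : 'I_n -> T -> H) w :
  bounded_operator (sample_covariance Xs w).
Proof.
apply: bounded_operatorZ; apply: bounded_operator_sum => i.
exact: bounded_operator_tensor.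
Qed.

Lemma sample_covariance_self_adjoint n (Xs : 'I_n -> T -> H) w :
  self_adjoint (sample_covariance Xs w).
Proof.
move=> u v; rewrite (innerC u) !sample_covariance_inner; congr (_ * _).
by apply: eq_bigr => i _; rewrite mulrC.
Qed.

(** For self-adjoint D, (D x) (x) (D x) = D (x (x) x) D. *)
Lemma sample_covariance_comp n (Xs : 'I_n -> T -> H) D w v :
  linear D -> self_adjoint D ->
  sample_covariance (fun i => D \o Xs i) w v = D (sample_covariance Xs w (D v)).
Proof.
move=> lD sD; rewrite /sample_covariance (linear_funZ _ _ lD) (linear_fun_sum _ _ _ lD).
congr (_ *: _); apply: eq_bigr => i _ /=.
by rewrite /tensor (linear_funZ _ _ lD) -sD.
Qed.

Lemma measurable_sample_covariance n (Xs : 'I_n -> T -> H) u v :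
  (forall i, random_vector (Xs i)) ->
  measurable_fun setT (fun w => inner (sample_covariance Xs w u) v : R).
Proof.
move=> mX; under eq_fun do rewrite sample_covariance_inner.
apply: measurable_funM => //; apply: measurable_sum => i.
by apply: measurable_funM; exact: measurable_inner.
Qed.

End covariance.

(** * Hypotheses on the sample are stable under bounded self-adjoint maps *)

Section transformed_sample.
Context {R : realType} {H : separableHilbertType R}.
Context {d : measure_display} {T : measurableType d} (P : probability T R).
Variables (X : T -> H) (S D : H -> H).
Hypotheses (bD : bounded_operator D) (sD : self_adjoint D).

Lemma centered_comp : centered P X -> centered P (D \o X).
Proof.
move=> cX u; rewrite -(cX (D u)); congr expectation.
by apply/funext=> w; rewrite /= sD.
Qed.

Lemma covariance_comp : is_covariance P X S -> is_covariance P (D \o X) (D \o S \o D).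
Proof.
move=> cS; split.
  apply: bounded_operator_comp => //; apply: bounded_operator_comp => //.
  by case: cS.
move=> u v; rewrite /= sD -(covariance_inner _ _ cS); congr expectation.
by apply/funext=> w; rewrite /= /tensor innerZl !sD.
Qed.

(** Since <D X, u> = <X, D u>, the moment condition for D X at [u] is the one for X at [D u], with
    the same constant. Boundedness of D gives the second moment. *)
Lemma subgaussian_comp C1 : random_vector X ->
  subgaussian P C1 X -> subgaussian P C1 (D \o X).
Proof.
move=> mX [fX sX]; split; last first.
  (* Both sides are abstracted over the scalar variable, so that <D X, u> is replaced in all its
     occurrences at once. *)
  move=> u; pose moments_le (Z : T -> R) := (ereal_sup
       [set (k%:R `^ (- 2^-1))%:E * 'E_P[fun w => (`|Z w| ^+ k)%R] `^ (k%:R^-1)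
       | k in [set k : nat | (1 <= k)%N]]
     <= C1%:E * 'E_P[fun w => (Z w ^+ 2)%R] `^ (2^-1))%E.
  rewrite -/(moments_le (fun w => inner ((D \o X) w) u)).
  rewrite (_ : (fun w => _) = (fun w => inner (X w) (D u))); first exact: sX.
  by apply/funext=> w; rewrite /= sD.
have [K K0 DK] := bounded_operator_bound bD.
have mn (Y : T -> H) : random_vector Y ->
    measurable_fun setT (fun w => (`|Y w| ^+ 2)%:E).
  move=> mY; apply/measurable_EFinP; apply: measurable_funX.
  exact: (measurable_real_comp (@norm_continuous _ H) mY).
rewrite /finite_second_moment unlock in fX *.
apply: (@le_lt_trans _ _ ((K ^+ 2)%:E * (\int[P]_w (`|X w| ^+ 2)%:E))%E).
  rewrite -ge0_integralZl//; last 2 first.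
  - exact: mn.
  - by rewrite lee_fin exprn_ge0.
  apply: ge0_le_integral => //.
  - exact: (mn (D \o X) (random_vector_comp bD.2 mX)).
  - apply: measurable_funeM; exact: mn.
  - move=> w _; rewrite -EFinM lee_fin -exprMn ler_pXn2r ?nnegrE ?mulr_ge0 //.
    exact: DK.
rewrite lte_mul_pinfty// lee_fin exprn_ge0//.
Qed.

Lemma independent_copies_comp n (Xs : 'I_n -> T -> H) : 
  independent_copies P X Xs -> independent_copies P (D \o X) (fun i => D \o Xs i).
Proof.
have [lD cD] := bD.
have mD (B : set (borel H)) : measurable B -> measurable (D @^-1` B : set (borel H)).
  by move=> mB; rewrite -[X in measurable X]setTI; exact: (continuous_borel cD).
move=> [mX eX iX]; split=> [i|i B mB|B mB].
- exact: random_vector_comp.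
- exact: (eX i (D @^-1` B) (mD _ mB)).
- exact: (iX (fun i => D @^-1` B i) (fun i => mD _ (mB i))).
Qed.

End transformed_sample.

(** * Koltchinskii-Lounici for linear images of the sample *)

Section concentration.
Context {R : realType} {H : separableHilbertType R}.
Context {d : measure_display} {T : measurableType d} (P : probability T R).
Variables (p : option nat) (X : T -> H) (S : H -> H) (lam : nat -> R)
  (u : nat -> H) (n : nat) (Xs : 'I_n -> T -> H) (C1 C3 : R).
Hypotheses (C3_gt1 : 1 < C3) (KL : koltchinskii_lounici C1 C3).
Hypotheses (mX : random_vector X) (cX : centered P X) (sX : subgaussian P C1 X)
  (cS : is_covariance P X S) (eS : eigendecomposition p S lam u)
  (lam_gt0 : forall j, in_dim p j -> 0 < lam j)
  (n_gt0 : (1 <= n)%N) (iX : independent_copies P X Xs).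

Let onb : orthonormal_basis p u. Proof. by case: eS. Qed.

Lemma eigenvectorE (D : H -> H) (delta : nat -> R) j :
  (forall j, in_dim p j -> D (u j) = delta j *: u j) -> linear D ->
  in_dim p j -> D (S (D (u j))) = (delta j ^+ 2 * lam j) *: u j.
Proof.
move=> Du lD pj; have [_ Su _] := eS.
have lS : linear S by case: cS => -[].
rewrite Du // linear_funZ // Su // linear_funZ // linear_funZ // Du // !scalerA.
by congr (_ *: _); ring.
Qed.

(** An eigenvector has some nonzero coordinate [j] in the basis [u]; comparing that coordinate on
    both sides of the eigenvalue equation shows that the eigenvalue is [delta j ^+ 2 * lam j]. *)
Lemma largest_eigenvalue_comp (D : H -> H) (delta : nat -> R) j0 :
  bounded_operator D -> self_adjoint D ->
  (forall j, in_dim p j -> D (u j) = delta j *: u j) ->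
  in_dim p j0 ->
  (forall j, in_dim p j -> delta j ^+ 2 * lam j <= delta j0 ^+ 2 * lam j0) ->
  is_largest_eigenvalue (D \o S \o D) (delta j0 ^+ 2 * lam j0).
Proof.
move=> [lD _] sD Du pj0 dmax; split.
  exists (u j0); last exact: eigenvectorE.
  apply/eqP => u0; have := onb_inner onb pj0 pj0.
  by rewrite u0 inner0l eqxx => /esym/eqP; rewrite oner_eq0.
move=> m [v v0 Av].
have /existsNP[j /not_implyP[pj /eqP vj0]] :
    ~ forall j, in_dim p j -> inner v (u j) = 0 :> R.
  by move=> h; move/eqP: v0; apply; exact: onb_eq0 h.
have sS := covariance_self_adjoint cS.
have : inner (D (S (D v))) (u j) = inner (m *: v) (u j) :> R by rewrite -Av.
rewrite sD sS sD (eigenvectorE Du) // innerZl innerZr => /eqP.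
by rewrite (inj_eq (mulIf vj0)) => /eqP <-; exact: dmax.
Qed.

(** The inequality is applied to D X, whose covariance D S D is diagonal in the basis [u]. It is
    used twice below: with D the projection onto the tail, and with D the operator A of the
    header. *)
Lemma concentration_event (D : H -> H) (delta : nat -> R) j0 (x : R) :
  bounded_operator D -> self_adjoint D ->
  (forall j, in_dim p j -> D (u j) = delta j *: u j) ->
  in_dim p j0 -> 0 < delta j0 ->
  (forall j, in_dim p j -> delta j ^+ 2 * lam j <= delta j0 ^+ 2 * lam j0) ->
  0 < x ->
  (\sum_(1 <= j <oo | in_dim p j) (delta j ^+ 2 * lam j)%:E <=
     (n%:R * (delta j0 ^+ 2 * lam j0) * Num.min x (x ^+ 2))%:E)%E ->
  exists A : set T, [/\ measurable A,
    (P A <= (expR (- (n%:R * Num.min x (x ^+ 2))))%:E)%E &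
    forall w, ~ A w -> forall v,
      `|D (S (D v) - sample_covariance Xs w (D v))| <=
      C3 * (delta j0 ^+ 2 * lam j0) * x * `|v|].
Proof.
move=> bD sD Du pj0 dj0 dmax x0 trx.
have [lD cD] := bD.
have bDSD : bounded_operator (D \o S \o D) by case: (covariance_comp bD sD cS).
have [mXs _ _] := iX.
pose Y i := D \o Xs i.
pose A w := fun v => (D \o S \o D) v - sample_covariance Y w v.
have AE w v : A w v = D (S (D v) - sample_covariance Xs w (D v)).
  by rewrite linear_funB // /A sample_covariance_comp.
have bA w : bounded_operator (A w).
  by apply: bounded_operatorB => //; exact: bounded_operator_sample_covariance.
set c := C3 * (delta j0 ^+ 2 * lam j0) * x.
have c0 : 0 < c by rewrite !mulr_gt0 ?exprn_gt0 ?lam_gt0 // (lt_trans ltr01).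
exists [set w | (c%:E < opnorm (A w))%E]; split.
- apply: (measurable_opnorm_gt onb) => //; last exact: ltW.
  move=> y v; under eq_fun do rewrite innerBl.
  apply: measurable_funB => //; apply: measurable_sample_covariance => i.
  exact: random_vector_comp.
- apply: (KL onb (X := D \o X) (Sigma := D \o S \o D)) => //.
  + exact: random_vector_comp.
  + exact: centered_comp.
  + exact: subgaussian_comp.
  + exact: covariance_comp.
  + exact: largest_eigenvalue_comp.
  + exact: independent_copies_comp.
  + apply: le_trans trx; rewrite /trace le_eqVlt; apply/orP; left; apply/eqP.
    apply: eq_eseriesr => j pj; congr EFin.
    by rewrite /= (eigenvectorE Du) // innerZl (onb_inner onb) // eqxx mulr1.
- move=> w /= /negP; rewrite -leNgt => Aw v.
  have [->|v0] := eqVneq v 0.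
    by rewrite -AE linear_fun0 ?normr0 ?mulr0 //; case: (bA w).
  have nv : 0 < `|v| by rewrite normr_gt0.
  have : ((`|A w (`|v|^-1 *: v)|)%:E <= c%:E)%E.
    apply: le_trans Aw; apply: ereal_sup_ubound; exists (`|v|^-1 *: v) => //=.
    by rewrite normrZ ger0_norm ?invr_ge0 // mulVf // gt_eqF.
  rewrite lee_fin linear_funZ; last by case: (bA w).
  rewrite normrZ ger0_norm ?invr_ge0 // AE mulrC ler_pdivrMr //.
Qed.

End concentration.

(** * Second moments of the sample covariance *)

Section independence.
Context {R : realType} {d : measure_display} {T : measurableType d}
  (P : probability T R).

(** Independence says that the joint law agrees with the product of the two laws on rectangles,
    hence everywhere; Fubini then factors the integral. *)
Lemma integral_prod_independent (Z1 Z2 : T -> R) :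
  measurable_fun setT Z1 -> measurable_fun setT Z2 ->
  (forall A B : set R, measurable A -> measurable B ->
     P (Z1 @^-1` A `&` Z2 @^-1` B) = (P (Z1 @^-1` A) * P (Z2 @^-1` B))%E) ->
  P.-integrable setT (EFin \o Z1) -> P.-integrable setT (EFin \o Z2) ->
  P.-integrable setT (EFin \o (fun w => Z1 w * Z2 w)) ->
  (\int[P]_w (Z1 w * Z2 w)%:E = \int[P]_w (Z1 w)%:E * \int[P]_w (Z2 w)%:E)%E.
Proof.
move=> mZ1 mZ2 ind i1 i2 i12.
pose Z w := (Z1 w, Z2 w).
have mZ : measurable_fun setT Z by exact: measurable_fun_pair.
pose Z1' : {mfun T >-> R} := HB.pack Z1 (isMeasurableFun.Build _ _ _ _ Z1 mZ1).
pose Z2' : {mfun T >-> R} := HB.pack Z2 (isMeasurableFun.Build _ _ _ _ Z2 mZ2).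
pose Z' : {mfun T >-> (R * R)%type} := HB.pack Z (isMeasurableFun.Build _ _ _ _ Z mZ).
pose m1 := distribution P Z1'; pose m2 := distribution P Z2'.
pose f (x : R * R) := (x.1 * x.2)%:E.
have mf : measurable_fun setT f.
  by apply/measurable_EFinP; apply: measurable_funM.
have mE : measurable_fun setT (@EFin R) by exact/measurable_EFinP.
have agree A : measurable A -> (m1 \x m2)%E A = pushforward P Z' A.
  apply: product_measure_unique => B C mB mC; exact: ind.
have -> : (\int[P]_w (Z1 w * Z2 w)%:E = \int[pushforward P Z']_x f x)%E.
  by rewrite integral_pushforward.
transitivity (\int[(m1 \x m2)%E]_x f x)%E.
  by apply: eq_measure_integral => A mA _; exact/esym/agree.
rewrite -integral12_prod_meas1; last first.
  have /integrableP[_ fy] : (pushforward P Z').-integrable setT f.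
    exact: integrable_pushforward.
  apply/integrableP; split=> //; apply: le_lt_trans fy.
  rewrite le_eqVlt (eq_measure_integral (pushforward P Z')) ?eqxx // => A mA _.
  exact: agree.
have e2 : (\int[m2]_y y%:E = \int[P]_w (Z2 w)%:E)%E by rewrite /m2 integral_pushforward.
have e1 : (\int[m1]_y y%:E = \int[P]_w (Z1 w)%:E)%E by rewrite /m1 integral_pushforward.
have j2 : m2.-integrable setT (@EFin R) by exact: integrable_pushforward.
have j1 : m1.-integrable setT (@EFin R) by exact: integrable_pushforward.
transitivity (\int[m1]_x (x%:E * \int[P]_w (Z2 w)%:E))%E.
  apply: eq_integral => x _; rewrite /fubini_F /f /= -e2.
  by under eq_integral do rewrite EFinM; rewrite integralZl.
have e2f : (\int[P]_w (Z2 w)%:E)%E \is a fin_num by exact: integrable_fin_num.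
by rewrite -(fineK e2f) integralZr // e1.
Qed.

End independence.

(** * Laws of the copies and their pairwise independence *)

Section copies.
Context {R : realType} {H : separableHilbertType R}.
Context {d : measure_display} {T : measurableType d} (P : probability T R).
Variables (X : T -> H) (n : nat) (Xs : 'I_n -> T -> H).
Hypotheses (mX : random_vector X) (iX : independent_copies P X Xs).

Let mXs i : random_vector (Xs i). Proof. by case: iX. Qed.

Lemma copies_integral i (f : H -> \bar R) :
  measurable_fun [set: borel H] (f : borel H -> \bar R) ->
  (forall x, 0 <= f x)%E ->
  (\int[P]_w f (Xs i w) = \int[P]_w f (X w))%E.
Proof.
move=> mf f0.
pose X' : {mfun T >-> borel H} := HB.pack (X : T -> borel H)
  (isMeasurableFun.Build _ _ _ _ (X : T -> borel H) mX).
pose Y' : {mfun T >-> borel H} := HB.pack (Xs i : T -> borel H)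
  (isMeasurableFun.Build _ _ _ _ (Xs i : T -> borel H) (mXs i)).
transitivity (\int[pushforward P Y']_x f x)%E.
  by rewrite ge0_integral_pushforward.
transitivity (\int[pushforward P X']_x f x)%E.
  have [_ eX _] := iX; apply: eq_measure_integral => A mA _; exact: (eX i A mA).
by rewrite ge0_integral_pushforward.
Qed.

Lemma copies_integrable i (f : H -> \bar R) :
  measurable_fun [set: borel H] (f : borel H -> \bar R) ->
  P.-integrable setT (f \o X) -> P.-integrable setT (f \o Xs i).
Proof.
move=> mf /integrableP[_ fX]; apply/integrableP; split.
  apply: (@measurable_comp _ _ _ _ _ _ [set: borel H]) => //; exact: mXs.
rewrite (copies_integral i (f := fun x => `|f x|%E)) //.
exact: measurableT_comp.
Qed.

Lemma copies_expectation i (f : H -> \bar R) :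
  measurable_fun [set: borel H] (f : borel H -> \bar R) ->
  P.-integrable setT (f \o X) ->
  (\int[P]_w f (Xs i w) = \int[P]_w f (X w))%E.
Proof.
move=> mf fX; have fY := copies_integrable i mf fX.
have pos := copies_integral i (measurable_funepos mf) (funepos_ge0 f).
have neg := copies_integral i (measurable_funeneg mf) (funeneg_ge0 f).
change (\int[P]_w (f \o Xs i) w = \int[P]_w (f \o X) w)%E.
rewrite integralE [RHS]integralE.
rewrite (funepos_comp f (Xs i)) (funepos_comp f X).
rewrite (funeneg_comp f (Xs i)) (funeneg_comp f X).
by congr (_ - _)%E; [exact: pos|exact: neg].
Qed.

(** Joint independence is used with the whole space as the event of every other copy. *)
Lemma copies_independent i k (A B : set (borel H)) : i != k ->
  measurable A -> measurable B ->
  P (Xs i @^-1` A `&` Xs k @^-1` B) = (P (Xs i @^-1` A) * P (Xs k @^-1` B))%E.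
Proof.
move=> ik mA mB; have [_ _ ind] := iX.
pose C j := if j == i then A else if j == k then B else setT : set (borel H).
have mC j : measurable (C j) by rewrite /C; case: ifP => // _; case: ifP.
have := ind C mC; rewrite (bigD1 i) //= (bigD1 k) 1?eq_sym //= big1 => [|j /andP[ji jk]].
  rewrite mule1 /C eqxx [k == i]eq_sym (negbTE ik) eqxx => <-; congr (P _).
  apply/seteqP; split => [w [Aw Bw] j _|w h].
    by case: ifP => [/eqP->//|_]; case: ifP => [/eqP->|].
  split; first by have := h i Logic.I; rewrite /= eqxx.
  by have := h k Logic.I; rewrite /= eqxx [k == i]eq_sym (negbTE ik).
by rewrite /C (negbTE ji) (negbTE jk) preimage_setT probability_setT.
Qed.

End copies.

(** * Fourth moments and the variance of sample covariance entries *)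

Section moments.
Context {R : realType} {H : separableHilbertType R}.
Context {d : measure_display} {T : measurableType d} (P : probability T R).

(** The case k = 4 of the moment condition, raised to the fourth power; the 16 is the inverse of
    (4^(-1/2))^4. *)
Lemma subgaussian_fourth_moment C1 (X : T -> H) u (l : R) :
  subgaussian P C1 X -> 0 <= l ->
  ('E_P[fun w => (inner (X w) u ^+ 2)%R] = l%:E)%E ->
  (\int[P]_w (inner (X w) u ^+ 4)%:E <= (16 * C1 ^+ 4 * l ^+ 2)%:E)%E.
Proof.
move=> [_ /(_ u) +] l0 El; rewrite El poweR_EFin => sup_le.
have {sup_le} := le_trans (@ereal_sup_ubound _ _ _
  (ex_intro2 _ _ 4%N (isT : (1 <= 4)%N) erefl)) sup_le.
rewrite unlock; set m := integral _ _ _.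
have -> : (\int[P]_w (inner (X w) u ^+ 4)%:E)%E = m.
  apply: eq_integral => w _; congr EFin.
  by rewrite -normrX ger0_norm // exprn_even_ge0.
have m0 : (0 <= m)%E by apply: integral_ge0 => w _; rewrite lee_fin exprn_ge0.
have c0 : 0 < (4%:R : R) `^ (- 2^-1) by rewrite powR_gt0.
clearbody m; case: m m0 => [r r0||//]; last first.
  (* An infinite fourth moment would make the left-hand side infinite, against a finite right-hand
     side. *)
  move=> _; rewrite poweRyr ?gt_eqF ?invr_gt0 // gt0_muley ?lte_fin //.
rewrite poweR_EFin -!EFinM !lee_fin => h.
have := lerXn2r 4 _ _ h; rewrite !nnegrE mulr_ge0 ?powR_ge0 //.
(* Taking fourth powers requires a nonnegative right-hand side; this is read off [h] rather than
   from a sign of [C1]. *)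
have le0 : 0 <= C1 * l `^ (2^-1) by apply: le_trans h; rewrite mulr_ge0 ?powR_ge0.
move=> /(_ isT le0); rewrite !exprMn.
have -> : ((4%:R : R) `^ (- 2^-1)) ^+ 4 = 16^-1.
  rewrite -powR_mulrn ?powR_ge0 // -powRrM (_ : - 2^-1 * 4%:R = - (2%:R)); last by field.
  by rewrite powRN powR_mulrn //; congr (_^-1); ring.
have -> : (r `^ 4%:R^-1) ^+ 4 = r.
  by rewrite -powR_mulrn ?powR_ge0 // -powRrM mulVf ?powRr1 // pnatr_eq0.
have -> : (l `^ 2^-1) ^+ 4 = l ^+ 2.
  rewrite -powR_mulrn ?powR_ge0 // -powRrM (_ : 2^-1 * 4%:R = 2%:R); last by field.
  by rewrite powR_mulrn.
lra.
Qed.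

Variables (X : T -> H) (n : nat) (Xs : 'I_n -> T -> H).
Hypotheses (mX : random_vector X) (iX : independent_copies P X Xs) (n_gt0 : (1 <= n)%N).

(** The square of the empirical mean is expanded into n^2 products. Off the diagonal they have mean
    zero by independence and centering; the n diagonal ones contribute at most n V / n^2. *)
Lemma sample_covariance_variance u v (V : R) :
  ('E_P[fun w => (inner (X w) u * inner (X w) v)%R] = 0)%E ->
  (\int[P]_w ((inner (X w) u * inner (X w) v) ^+ 2)%:E <= V%:E)%E ->
  (\int[P]_w (inner (sample_covariance Xs w u) v ^+ 2)%:E <= (V / n%:R)%:E)%E.
Proof.
move=> mean0 var_le; pose f x : R := inner x u * inner x v.
have mf : measurable_fun [set: borel H] (f : borel H -> R).
  by apply: measurable_funM; apply: continuous_borel_real; exact: inner_continuousl.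
have mZ i : measurable_fun setT (fun w => f (Xs i w)).
  by apply: (@measurable_comp _ _ _ _ _ _ [set: borel H]) => //; case: iX => + _ _; exact.
have mfX : measurable_fun setT (fun w => f (X w)).
  by apply: (@measurable_comp _ _ _ _ _ _ [set: borel H]).
have mfsq : measurable_fun [set: borel H] (fun x => (f x ^+ 2)%:E).
  by apply/measurable_EFinP; exact: measurable_funX.
have fsq0 x : (0 <= (f x ^+ 2)%:E)%E by rewrite lee_fin sqr_ge0.
have int_sq : P.-integrable setT (fun w => (f (X w) ^+ 2)%:E).
  apply/integrableP; split; first by apply/measurable_EFinP; exact: measurable_funX.
  under eq_integral do rewrite gee0_abs //.
  by apply: le_lt_trans var_le _; rewrite ltry.
(* Integrability of f follows from that of its square through |f| <= 1 + f^2. *)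
have int_f : P.-integrable setT (fun w => (f (X w))%:E).
  apply: (@le_integrable _ _ _ _ _ _ _ (fun w => (1 + f (X w) ^+ 2)%:E)) => //.
  - exact/measurable_EFinP.
  - move=> w _; rewrite lee_fin [leRHS]ger0_norm ?addr_ge0 ?sqr_ge0 //.
    have := sqr_ge0 (`|f (X w)| - 1); rewrite -(@real_normK _ (f (X w))) ?num_real //.
    by have := normr_ge0 (f (X w)); nra.
  under eq_fun do rewrite EFinD; apply: integrableD => //.
  by apply: finite_measure_integrable_cst.
have int_Zsq i : P.-integrable setT (fun w => (f (Xs i w) ^+ 2)%:E).
  exact: (copies_integrable mX iX i mfsq).
have int_Z i : P.-integrable setT (fun w => (f (Xs i w))%:E).
  by apply: (copies_integrable mX iX i (f := EFin \o f)) => //; exact/measurable_EFinP.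
have int_ZZ i k : P.-integrable setT (fun w => (f (Xs i w) * f (Xs k w))%:E).
  apply: (@le_integrable _ _ _ _ _ _ _
    (fun w => (f (Xs i w) ^+ 2 + f (Xs k w) ^+ 2)%:E)) => //.
  - by apply/measurable_EFinP; exact: measurable_funM.
  - move=> w _; rewrite lee_fin [leRHS]ger0_norm ?addr_ge0 ?sqr_ge0 // normrM.
    rewrite -(@real_normK _ (f (Xs i w))) ?num_real //.
    rewrite -(@real_normK _ (f (Xs k w))) ?num_real //.
    have := sqr_ge0 (`|f (Xs i w)| - `|f (Xs k w)|).
    by have := normr_ge0 (f (Xs i w)); have := normr_ge0 (f (Xs k w)); nra.
  by under eq_fun do rewrite EFinD; apply: integrableD.
have EZ0 i : (\int[P]_w (f (Xs i w))%:E = 0)%E.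
  rewrite (copies_expectation mX iX i (f := EFin \o f)) //.
    by move: mean0; rewrite unlock.
  exact/measurable_EFinP.
have EZZ i k : i != k -> (\int[P]_w (f (Xs i w) * f (Xs k w))%:E = 0)%E.
  move=> ik; rewrite (integral_prod_independent (mZ i) (mZ k) _
    (int_Z i) (int_Z k) (int_ZZ i k)) ?EZ0 ?mul0e // => A B mA mB.
  have mfI (C : set R) : measurable C -> measurable (f @^-1` C : set (borel H)).
    by move=> mC; rewrite -[X in measurable X]setTI; exact: mf.
  exact: (copies_independent iX ik (mfI _ mA) (mfI _ mB)).
have n0 : (n%:R : R) != 0 by rewrite pnatr_eq0 -lt0n.
have -> : (\int[P]_w (inner (sample_covariance Xs w u) v ^+ 2)%:E =
    \int[P]_w ((n%:R ^- 2)%:E *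
      \sum_(i < n) \sum_(k < n) (f (Xs i w) * f (Xs k w))%:E))%E.
  apply: eq_integral => w _; rewrite sample_covariance_inner exprMn exprVn EFinM.
  rewrite -/(f _); congr (_ * _)%E; rewrite expr2 mulr_suml -sumEFin.
  by apply: eq_bigr => i _; rewrite mulr_sumr -sumEFin.
rewrite integralZl //; last first.
  by apply: integrable_sum => // i _; apply: integrable_sum.
rewrite integral_sum //; last by move=> i; apply: integrable_sum.
apply: (@le_trans _ _ ((n%:R ^- 2)%:E * \sum_(i < n) V%:E)%E); last first.
  rewrite sumEFin -EFinM lee_fin sumr_const card_ord -[V *+ n]mulr_natl.
  by rewrite le_eqVlt; apply/orP; left; apply/eqP; field.
apply: lee_wpmul2l; first by rewrite lee_fin invr_ge0 exprn_ge0.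
apply: lee_sum => i _; rewrite integral_sum // (bigD1 i) //= big1 ?adde0 => [|k ki].
  by have -> : (\int[P]_w (f (Xs i w) * f (Xs i w))%:E = \int[P]_w (f (X w) ^+ 2)%:E)%E
    by exact: (copies_integral mX iX i mfsq fsq0).
by rewrite EZZ // eq_sym.
Qed.

(** Coordinates along distinct eigenvectors are uncorrelated, so their product is centered and the
    previous variance bound applies; the second moment of the product is controlled by the two
    fourth moments. *)
Lemma sample_covariance_eigen_variance C1 p (S : H -> H) lam e j l :
  subgaussian P C1 X -> is_covariance P X S -> eigendecomposition p S lam e ->
  in_dim p j -> in_dim p l -> j != l -> 0 < lam j -> 0 < lam l ->
  (\int[P]_w (inner (sample_covariance Xs w (e j)) (e l) ^+ 2)%:E
     <= (16 * C1 ^+ 4 * lam j * lam l / n%:R)%:E)%E.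
Proof.
move=> sX cS [onb Se _] pj pl jl lj ll.
have cov i k : in_dim p i -> in_dim p k ->
    ('E_P[fun w => (inner (X w) (e i) * inner (X w) (e k))%R] =
    (lam i * (i == k)%:R)%:E)%E.
  by move=> pi pk; rewrite (covariance_inner _ _ cS) Se // innerZl (onb_inner onb).
apply: sample_covariance_variance; first by rewrite cov // (negbTE jl) mulr0.
have m4 i : in_dim p i -> 0 < lam i ->
    (\int[P]_w (inner (X w) (e i) ^+ 4)%:E <= (16 * C1 ^+ 4 * lam i ^+ 2)%:E)%E.
  move=> pi li; apply: subgaussian_fourth_moment => //; first exact: ltW.
  by have := cov i i pi pi; rewrite eqxx mulr1.
have mi i : measurable_fun setT (fun w => (inner (X w) (e i) ^+ 4)%:E).
  by apply/measurable_EFinP; apply: measurable_funX; exact: measurable_inner.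
(* AM-GM with weights that balance the two fourth moments; this replaces the
   Cauchy-Schwarz inequality. *)
pose t := lam l / lam j; have t0 : 0 < t by rewrite divr_gt0.
apply: (@le_trans _ _ (\int[P]_w ((t / 2)%:E * (inner (X w) (e j) ^+ 4)%:E +
    (t^-1 / 2)%:E * (inner (X w) (e l) ^+ 4)%:E))%E).
  apply: ge0_le_integral => //.
  - by move=> w _; rewrite lee_fin sqr_ge0.
  - apply/measurable_EFinP; apply: measurable_funX; apply: measurable_funM;
      exact: measurable_inner.
  - by apply: emeasurable_funD; exact: measurable_funeM.
  - move=> w _; rewrite -!EFinM -EFinD lee_fin.
    set a := inner _ _; set b := inner _ _.
    rewrite -subr_ge0 (_ : _ - _ = (t * a ^+ 2 - b ^+ 2) ^+ 2 / (2 * t)).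
      by rewrite divr_ge0 ?sqr_ge0 // mulr_ge0 // ltW.
    by field; rewrite gt_eqF.
rewrite ge0_integralD //; last 4 first.
- by move=> w _; rewrite -EFinM lee_fin mulr_ge0 ?exprn_even_ge0 // divr_ge0 // ltW.
- exact: measurable_funeM.
- move=> w _; rewrite -EFinM lee_fin mulr_ge0 ?exprn_even_ge0 // divr_ge0 //.
  by rewrite invr_ge0 ltW.
- exact: measurable_funeM.
have q0 i w : setT w -> (0 <= (inner (X w) (e i) ^+ 4)%:E)%E.
  by move=> _; rewrite lee_fin exprn_even_ge0.
have th0 : (0 <= (t / 2)%:E)%E by rewrite lee_fin divr_ge0 // ltW.
have tv0 : (0 <= (t^-1 / 2)%:E)%E by rewrite lee_fin divr_ge0 // invr_ge0 ltW.
rewrite !ge0_integralZl //; try exact: q0.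
apply: (le_trans (leeD (lee_wpmul2l th0 (m4 j pj lj)) (lee_wpmul2l tv0 (m4 l pl ll)))).
rewrite -!EFinM -EFinD lee_fin /t le_eqVlt; apply/orP; left; apply/eqP.
by field; rewrite !gt_eqF.
Qed.

End moments.

(** * Perturbation of spectral projections *)

Section diagonal_operators.
Context {R : realType} {H : separableHilbertType R}.
Variables (p : option nat) (u : nat -> H).
Hypothesis onb : orthonormal_basis p u.
Implicit Types (c : nat -> R) (m j : nat) (x y : H).

(** With [c j] the inverse square root of the gap this is the operator A of the header; with [c j]
    the square root itself it inverts A on the span of the first [m] basis vectors. *)
Definition diag_operator c m x : H :=
  \sum_(1 <= j < m.+1) c j *: tensor (u j) (u j) x.

Lemma diag_operator_inner c m x y :
  inner (diag_operator c m x) y =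
  \sum_(1 <= j < m.+1) c j * (inner x (u j) * inner y (u j)) :> R.
Proof.
rewrite /diag_operator inner_suml; apply: eq_bigr => j _.
by rewrite /tensor !innerZl (innerC (u j) x) (innerC (u j) y).
Qed.

Lemma diag_operator_self_adjoint c m : self_adjoint (diag_operator c m).
Proof.
move=> x y; rewrite (innerC x) !diag_operator_inner.
by apply: eq_bigr => j _; rewrite [inner x _ * _]mulrC.
Qed.

Lemma diag_operator_bounded c m : bounded_operator (diag_operator c m).
Proof.
apply: bounded_operator_sum => j; apply: bounded_operatorZ.
exact: bounded_operator_tensor.
Qed.

Lemma diag_operator_onb c m x j : in_dim p m -> in_dim p j ->
  inner (diag_operator c m x) (u j) =
  (if (j <= m)%N then c j * inner x (u j) else 0) :> R.
Proof.
move=> pm pj; rewrite diag_operator_inner.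
rewrite (eq_big_nat _ _
    (F2 := fun i => if i == j then c j * inner x (u j) else 0)).
  by rewrite -big_mkcond big_nat1_eq ltnS; case/andP: pj => ->.
move=> i /andP[i1 im]; rewrite (onb_inner onb) // 1?eq_sym; last first.
  by apply: in_dim_le pm; rewrite i1.
by case: eqVneq => [->|_]; rewrite ?mulr1 ?mulr0.
Qed.

Lemma diag_operator_basis c m j : in_dim p m -> in_dim p j ->
  diag_operator c m (u j) = (if (j <= m)%N then c j else 0) *: u j.
Proof.
move=> pm pj; apply/eqP; rewrite -subr_eq0; apply/eqP.
apply: (onb_eq0 onb) => i pi; rewrite innerBl innerZl diag_operator_onb //.
rewrite (onb_inner onb) //.
case: (eqVneq j i) => [->|_]; rewrite ?mulr0 ?if_same ?subr0 //.
by case: ifP => _; rewrite ?mulr1 ?mul0r subrr.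
Qed.

Lemma diag_operator_sqnorm c m x : in_dim p m ->
  inner (diag_operator c m x) (diag_operator c m x) =
  \sum_(1 <= j < m.+1) c j ^+ 2 * inner x (u j) ^+ 2 :> R.
Proof.
move=> pm; rewrite diag_operator_inner; apply: eq_big_nat => j /andP[j0].
rewrite ltnS => jm; rewrite diag_operator_onb ?jm //; last first.
  by apply: in_dim_le pm; rewrite j0.
by ring.
Qed.

Lemma residual_onb m x j : in_dim p m -> in_dim p j ->
  inner (x - eigenprojection u m x) (u j) =
  (if (j <= m)%N then 0 else inner x (u j)) :> R.
Proof.
move=> pm pj; rewrite innerBl (eigenprojection_onb onb) //.
by case: ifP => _; rewrite ?subrr ?subr0.
Qed.

Lemma residual_sqnorm m x : in_dim p m ->
  inner (x - eigenprojection u m x) (x - eigenprojection u m x) =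
  inner (x - eigenprojection u m x) x :> R.
Proof.
move=> pm; rewrite innerBr [X in _ - X](_ : _ = 0) ?subr0 //.
rewrite inner_sumr big_nat big1 // => j; rewrite ltnS => jm.
rewrite /tensor innerZr residual_onb ?(in_dim_le jm) //.
by have /andP[_ ->] := jm; rewrite mulr0.
Qed.

Lemma bounded_operator_residual m :
  bounded_operator (fun x => x - eigenprojection u m x).
Proof.
apply: (bounded_operatorB (A := idfun)); first exact: bounded_operator_id.
exact: bounded_operator_eigenprojection.
Qed.

Lemma residual_self_adjoint m : self_adjoint (fun x => x - eigenprojection u m x).
Proof.
by move=> x y; rewrite innerBl innerBr self_adjoint_eigenprojection.
Qed.

Lemma residual_basis m j : in_dim p m -> in_dim p j ->
  u j - eigenprojection u m (u j) = (if (j <= m)%N then 0 else 1) *: u j.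
Proof.
move=> pm pj; apply/eqP; rewrite -subr_eq0; apply/eqP.
apply: (onb_eq0 onb) => i pi; rewrite innerBl innerZl residual_onb //.
rewrite (onb_inner onb) //.
case: (eqVneq j i) => [->|_]; rewrite ?mulr0 ?if_same ?subr0 //.
by case: ifP => _; rewrite ?mulr1 ?mul0r subrr.
Qed.

End diagonal_operators.

(** * Comparison of the eigenvalues of index d + 1 *)

Section eigenvalue_bound.
Context {R : realType} {H : separableHilbertType R}.
Variables (p : option nat) (S Sh : H -> H) (lam lamh : nat -> R) (u uh : nat -> H).
Variable d : nat.
Hypotheses (eS : eigendecomposition p S lam u) (sS : self_adjoint S).
Hypotheses (eSh : eigendecomposition p Sh lamh uh) (lSh : linear Sh).
Hypothesis pd : in_dim p d.+1.

Let onb : orthonormal_basis p u. Proof. by case: eS. Qed.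
Let onbh : orthonormal_basis p uh. Proof. by case: eSh. Qed.

(** Rank at most [m] cannot make [m.+1] rows independent. It provides a nontrivial solution of [d]
    linear equations in [d.+1] unknowns. *)
Lemma exists_row_kernel (F : fieldType) m (M : 'M[F]_(m.+1, m)) :
  exists2 a : 'rV[F]_(m.+1), a != 0 & a *m M = 0.
Proof.
have : kermx M != 0.
  by rewrite kermx_eq0 -row_leq_rank -ltnNge (leq_ltn_trans (rank_leq_col M)).
by case/rowV0Pn => a /sub_kermxP aM a0; exists a.
Qed.

Lemma exists_orthogonal_combination : exists a : 'rV[R]_(d.+1),
  a != 0 /\ forall i, (1 <= i <= d)%N ->
    inner (\sum_(k < d.+1) a 0 k *: uh k.+1) (u i) = 0 :> R.
Proof.
(* Ordinals start at 0 and bases at 1, hence the shifts [k.+1] and [i.+1]. *)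
pose M := \matrix_(k < d.+1, i < d) (inner (uh k.+1) (u i.+1) : R).
have [a a0 aM] := exists_row_kernel M; exists a; split=> // i /andP[i0 id].
have id' : (i.-1 < d)%N by rewrite prednK.
have /matrixP/(_ 0 (Ordinal id')) := aM; rewrite !mxE => h.
rewrite inner_suml -[RHS]h; apply: eq_bigr => k _.
by rewrite innerZl mxE /= prednK.
Qed.

Let ph (k : 'I_d.+1) : in_dim p k.+1.
Proof. by apply: in_dim_le pd; rewrite ltn_ord. Qed.

Lemma combination_sqnorm (a : 'rV[R]_(d.+1)) :
  inner (\sum_(k < d.+1) a 0 k *: uh k.+1) (\sum_(k < d.+1) a 0 k *: uh k.+1) =
  \sum_(k < d.+1) a 0 k ^+ 2 :> R.
Proof.
rewrite inner_suml; apply: eq_bigr => k _; rewrite inner_sumr (bigD1 k) //=.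
rewrite innerZl innerZr (onb_inner onbh) // eqxx big1 ?addr0 => [|i ik].
  by rewrite mulr1 expr2.
rewrite innerZl innerZr (onb_inner onbh) // eqSS (inj_eq val_inj) eq_sym.
by rewrite (negbTE ik) !mulr0.
Qed.

Lemma combination_rayleigh (a : 'rV[R]_(d.+1)) v :
  v = \sum_(k < d.+1) a 0 k *: uh k.+1 ->
  lamh d.+1 * inner v v <= inner (Sh v) v.
Proof.
move=> vE; have [_ Shu dec] := eSh.
have -> : inner (Sh v) v = \sum_(k < d.+1) lamh k.+1 * a 0 k ^+ 2.
  rewrite vE (linear_fun_sum _ _ _ lSh) inner_suml.
  apply: eq_bigr => k _; rewrite (linear_funZ _ _ lSh) Shu // inner_sumr (bigD1 k) //=.
  rewrite !innerZl innerZr (onb_inner onbh) // eqxx big1 ?addr0 => [|i ik].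
    by rewrite mulr1; ring.
  rewrite !innerZl innerZr (onb_inner onbh) // eqSS (inj_eq val_inj) eq_sym.
  by rewrite (negbTE ik) !mulr0.
rewrite vE combination_sqnorm mulr_sumr; apply: ler_sum => k _.
by rewrite ler_wpM2r ?sqr_ge0 // dec.
Qed.

(** In the Parseval expansion of <S v, v> only indices beyond [d] contribute, and their eigenvalues
    are at most [lam d.+1]; the comparison of partial sums passes to the limit. *)
Lemma rayleigh_le_orthogonal v :
  (forall i, (1 <= i <= d)%N -> inner v (u i) = 0 :> R) ->
  inner (S v) v <= lam d.+1 * inner v v.
Proof.
move=> vu; have [_ Su dec] := eS.
have lim1 := @parseval _ _ _ _ onb (S v) v.
have lim2 : (fun N => lam d.+1 *
    \sum_(1 <= j < N.+1 | in_dim p j) inner v (u j) * inner v (u j))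
    @ \oo --> lam d.+1 * inner v v.
  by apply: cvgM; [exact: cvg_cst|exact: (parseval onb)].
apply: (ler_cvg_to lim1 lim2); apply: nearW => N.
rewrite mulr_sumr; apply: ler_sum => j pj.
have [jd|dj] := leqP j d.
  by rewrite !vu ?mulr0 // jd andbT; case/andP: pj.
rewrite sS Su // innerZr -mulrA ler_wpM2r ?dec //.
by rewrite -expr2 sqr_ge0.
Qed.

(* Courant-Fischer: the span of the first d + 1 eigenvectors of Sh contains a
   nonzero vector orthogonal to u_1, ..., u_d. *)
Lemma eigenvalue_le_residual (c : R) :
  (forall v, `|S (v - eigenprojection u d v) - Sh (v - eigenprojection u d v) -
     eigenprojection u d (S (v - eigenprojection u d v) -
       Sh (v - eigenprojection u d v))| <= c * `|v|) ->
  lamh d.+1 <= lam d.+1 + c.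
Proof.
move=> hc; have [a [a0 av]] := exists_orthogonal_combination.
set v := \sum_(k < d.+1) _ in av.
have vv : 0 < inner v v :> R.
  rewrite combination_sqnorm; have [k ak] : exists k, a 0 k != 0.
    apply/existsP; apply: contraNT a0; rewrite negb_exists => /forallP ha.
    by apply/eqP/rowP => k; rewrite mxE; apply/eqP; have := ha k; rewrite negbK.
  rewrite (bigD1 k) //= ltr_wpDr ?sumr_ge0 // => [i _|].
    exact: sqr_ge0.
  by rewrite exprn_even_gt0.
have Pv : eigenprojection u d v = 0.
  rewrite /eigenprojection big_nat_cond big1 // => i /andP[id _].
  by rewrite /tensor innerC av // scale0r.
have := combination_rayleigh (erefl v); have := rayleigh_le_orthogonal av.
rewrite -/v; have := hc v; rewrite Pv subr0; set z := S v - Sh v => hz h1 h2.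
have zv : inner z v = inner (S v) v - inner (Sh v) v by rewrite innerBl.
(* The projection annihilates [v], so [z] may be replaced by its residual, which is what [hc]
   bounds; Cauchy-Schwarz concludes. *)
have : - (c * inner v v) <= inner z v.
  have -> : inner z v = inner (z - eigenprojection u d z) v.
    by rewrite innerBl self_adjoint_eigenprojection Pv inner0r subr0.
  have := inner_abs_le (z - eigenprojection u d z) v.
  rewrite ler_norml => /andP[+ _]; apply: le_trans; rewrite lerN2.
  by rewrite -sqr_normE expr2 mulrA ler_wpM2r.
by rewrite zv => h3; rewrite -(ler_pM2r vv) mulrDl; lra.
Qed.

End eigenvalue_bound.


(** * Gap-weighted bound on the residuals of the leading eigenvectors *)

Section residual_bound.
Context {R : realType} {H : separableHilbertType R}.
Variables (p : option nat) (S Sh : H -> H) (lam lamh : nat -> R) (u uh : nat -> H).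
Variables d s : nat.
Hypotheses (eS : eigendecomposition p S lam u) (sS : self_adjoint S).
Hypotheses (eSh : eigendecomposition p Sh lamh uh) (sSh : self_adjoint Sh).
Hypotheses (pd : in_dim p d.+1) (sd : (1 <= s <= d)%N).

Let onb : orthonormal_basis p u. Proof. by case: eS. Qed.
Let onbh : orthonormal_basis p uh. Proof. by case: eSh. Qed.
Let ps : in_dim p s.
Proof. by case/andP: sd => s0 sd'; apply: in_dim_le pd; rewrite s0 leqW. Qed.
Let pj j : (1 <= j <= s)%N -> in_dim p j.
Proof. by move=> h; exact: in_dim_le ps. Qed.
Let pd' : in_dim p d.
Proof.
by case/andP: sd => s0 sd'; apply: in_dim_le pd; rewrite (leq_trans s0 sd') leqnSn.
Qed.

Local Notation gap j := (lam j - lam d.+1).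
Hypothesis gap_gt0 : 0 < gap s.
Hypothesis lamh_le : lamh d.+1 <= lam d.+1 + gap s / 2.

(** The operator A of the header: an inverse square root of [S] shifted by [lam d.+1], on the span
    of the first [s] eigenvectors. *)
Let S_half := diag_operator u (fun j => (Num.sqrt (gap j))^-1) s.
Hypothesis whitened_le :
  forall v, `|S_half (S (S_half v) - Sh (S_half v))| <= 4^-1 * `|v|.

Let gap_j j : (1 <= j <= s)%N -> 0 < gap j.
Proof.
move=> js; apply: lt_le_trans gap_gt0 _; rewrite lerB //.
have [_ _ dec] := eS; have /andP[_ js'] := js.
by apply: dec => //; exact: pj.
Qed.

(** For [j <= s] the same projection kills [S (u j)], so this is also the part of -Delta u_j beyond
    [s]. *)
Let res j : H := Sh (u j) - eigenprojection u s (Sh (u j)).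

(** The eigenvalue equations give <Delta u_j, hat u_k> = (lam_j - hat lam_k) <u_j, hat u_k>. As k >
    d, [lamh_le] makes the first factor at least half the gap of [j]; squaring yields the 4. *)
Lemma spectral_perturbation j k : (1 <= j <= s)%N -> in_dim p k -> (d < k)%N ->
  gap j * inner (u j) (uh k) ^+ 2 <=
  4 * ((gap j)^-1 * inner (S (u j) - Sh (u j)) (uh k) ^+ 2).
Proof.
move=> js pk dk; have [_ Su dec] := eS; have [_ Shu dech] := eSh.
have gj := gap_j js.
have -> : inner (S (u j) - Sh (u j)) (uh k) = (lam j - lamh k) * inner (u j) (uh k).
  by rewrite innerBl sSh Su ?pj // Shu // innerZl innerZr mulrBl.
have diff : gap j / 2 <= lam j - lamh k.
  have h1 := dech _ _ pd pk dk.
  have h2 : lam s <= lam j.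
    by have /andP[_ js'] := js; apply: dec => //; exact: pj.
  have h3 := lamh_le; lra.
have scale c g x : 0 < g ->
    4 * (g^-1 * (c * x) ^+ 2) = g * x ^+ 2 * (2 * c / g) ^+ 2 :> R.
  by move=> g0; field; rewrite gt_eqF.
rewrite scale //; apply: ler_peMr; first by rewrite mulr_ge0 ?sqr_ge0 // ltW.
apply: exprn_ege1.
by rewrite ler_pdivlMr // mul1r; lra.
Qed.

(** The vector [b] is chosen so that A b is the projection of [x] onto the first [s] eigenvectors.
    That part of [x] produces A Delta A b, and the complementary part produces [res j]. *)
Lemma whitening_split j x : (1 <= j <= s)%N ->
  let b := diag_operator u (fun i => Num.sqrt (gap i)) s x in
  (Num.sqrt (gap j))^-1 * inner (S (u j) - Sh (u j)) x =
  inner (S_half (S (S_half b) - Sh (S_half b))) (u j)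
  - (Num.sqrt (gap j))^-1 * inner (res j) x :> R.
Proof.
move=> js b; have [_ Su dec] := eS; have pjj := pj js.
have sH : self_adjoint S_half by exact: diag_operator_self_adjoint.
have Sb : S_half b = eigenprojection u s x.
  apply/eqP; rewrite -subr_eq0; apply/eqP; apply: (onb_eq0 onb) => i pi.
  rewrite innerBl /S_half (diag_operator_onb onb) // (eigenprojection_onb onb) //.
  case: ifPn => // [is_|_]; last by rewrite subrr.
  rewrite (diag_operator_onb onb) // is_ mulrA mulVf ?mul1r ?subrr //.
  by rewrite gt_eqF // sqrtr_gt0 gap_j // is_ andbT; case/andP: pi.
have Sj : S_half (u j) = (Num.sqrt (gap j))^-1 *: u j.
  by rewrite /S_half (diag_operator_basis onb) //; have /andP[_ ->] := js.
rewrite sH Sj innerZr -mulrBr Sb; congr (_ * _).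
rewrite -[in LHS](subrK (eigenprojection u s x) x) innerDr addrC; congr (_ + _).
  by rewrite innerBl sS sSh -innerBr innerC.
(* [S (u j)] is a multiple of [u j], hence vanishes after the residual projection; only the [Sh]
   term remains. *)
rewrite -(residual_self_adjoint u) Su // /res.
rewrite (linear_funB _ _ (bounded_operator_residual u s).1).
rewrite (linear_funZ _ _ (bounded_operator_residual u s).1).
rewrite (residual_basis onb) //; have /andP[_ ->] := js.
by rewrite scale0r scaler0 sub0r innerNl.
Qed.

(* The factor 1/2 is 8 |S_half (S - Sh) S_half|^2 <= 8/16; summed over k > d, the
   first term on the right is half of the left-hand side and can be absorbed. *)
Lemma weighted_residual_step k : in_dim p k -> (d < k)%N ->
  \sum_(1 <= j < s.+1) gap j * inner (u j) (uh k) ^+ 2 <=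
  2^-1 * (\sum_(1 <= j < s.+1) gap j * inner (u j) (uh k) ^+ 2) +
  8 * (\sum_(1 <= j < s.+1) (gap j)^-1 * inner (res j) (uh k) ^+ 2).
Proof.
move=> pk dk; pose b := diag_operator u (fun i => Num.sqrt (gap i)) s (uh k).
pose w := S_half (S (S_half b) - Sh (S_half b)).
have sqr_gap j : (1 <= j <= s)%N -> Num.sqrt (gap j) ^+ 2 = gap j.
  by move=> js; rewrite sqr_sqrtr // ltW // gap_j.
have bb : inner b b = \sum_(1 <= j < s.+1) gap j * inner (u j) (uh k) ^+ 2.
  rewrite (diag_operator_sqnorm onb) //; apply: eq_big_nat => j.
  by rewrite ltnS => js; rewrite sqr_gap // innerC.
have ww : inner w w <= 16^-1 * inner b b.
  have := whitened_le b; rewrite -/w => h.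
  have := lerXn2r 2 _ _ h; rewrite !nnegrE mulr_ge0 // => /(_ (normr_ge0 _) isT).
  rewrite exprMn !sqr_normE (_ : 4^-1 ^+ 2 = 16^-1) //.
  by rewrite exprVn; congr (_^-1); ring.
have step : \sum_(1 <= j < s.+1) gap j * inner (u j) (uh k) ^+ 2 <=
    \sum_(1 <= j < s.+1) (8 * inner w (u j) ^+ 2 +
      8 * ((gap j)^-1 * inner (res j) (uh k) ^+ 2)).
  rewrite big_nat [leRHS]big_nat; apply: ler_sum => j; rewrite ltnS => js.
  apply: le_trans (spectral_perturbation js pk dk) _.
  rewrite -{1 2}(sqr_gap j js) -!exprVn -!exprMn whitening_split // -/b -/w.
  (* The bound (x - y)^2 <= 2 x^2 + 2 y^2 turns the factor 4 into 8. *)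
  set x := inner w _; set y := (Num.sqrt _)^-1 * _.
  rewrite -subr_ge0 (_ : _ - _ = 4 * (x + y) ^+ 2); last by ring.
  by rewrite mulr_ge0 ?sqr_ge0.
apply: le_trans step _; rewrite big_split /= -!mulr_sumr -bb lerD2r.
have bes : \sum_(1 <= j < s.+1) inner w (u j) ^+ 2 <= inner w w :> R.
  by rewrite (big_in_dim _ _ ps); exact: bessel.
lra.
Qed.

(** The one-index estimate is summed over d < k <= N; half of the finite quantity [G N] is absorbed
    into the left-hand side, which doubles 8 to 16, and N tends to infinity. *)
Lemma weighted_residual_bound :
  \sum_(1 <= j < s.+1)
    gap j * inner (u j - eigenprojection uh d (u j)) (u j) <=
  16 * (\sum_(1 <= j < s.+1) (gap j)^-1 *
    inner (Sh (u j) - eigenprojection u s (Sh (u j))) (Sh (u j))).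
Proof.
rewrite [X in 16 * X](eq_bigr
    (fun j => (gap j)^-1 * inner (res j) (res j))) => [|j _]; last first.
  by rewrite /res (residual_sqnorm onb).
pose G N := \sum_(1 <= j < s.+1) gap j *
  \sum_(d.+1 <= k < N.+1 | in_dim p k) inner (u j) (uh k) ^+ 2.
have G_le N : G N <= 16 * (\sum_(1 <= j < s.+1) (gap j)^-1 * inner (res j) (res j)).
  have GE : G N = \sum_(d.+1 <= k < N.+1 | in_dim p k)
      \sum_(1 <= j < s.+1) gap j * inner (u j) (uh k) ^+ 2.
    by rewrite exchange_big /=; apply: eq_bigr => j _; rewrite mulr_sumr.
  have : G N <= 2^-1 * G N + 8 * (\sum_(1 <= j < s.+1) (gap j)^-1 *
      \sum_(d.+1 <= k < N.+1 | in_dim p k) inner (res j) (uh k) ^+ 2).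
    rewrite [X in _ <= _ + 8 * X](_ : _ = \sum_(d.+1 <= k < N.+1 | in_dim p k)
       \sum_(1 <= j < s.+1) (gap j)^-1 * inner (res j) (uh k) ^+ 2); last first.
      by rewrite exchange_big /=; apply: eq_bigr => j _; rewrite mulr_sumr.
    rewrite GE !mulr_sumr -big_split /= big_nat_cond [leRHS]big_nat_cond.
    apply: ler_sum => k /andP[/andP[dk _] pk].
    exact: weighted_residual_step.
  have : \sum_(1 <= j < s.+1) (gap j)^-1 *
      (\sum_(d.+1 <= k < N.+1 | in_dim p k) inner (res j) (uh k) ^+ 2) <=
      \sum_(1 <= j < s.+1) (gap j)^-1 * inner (res j) (res j).
    rewrite big_nat [leRHS]big_nat; apply: ler_sum => j; rewrite ltnS => js.
    apply: ler_wpM2l; first by rewrite invr_ge0 ltW // gap_j.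
    exact: (bessel onbh).
  lra.
have Gcvg : G @ \oo --> \sum_(1 <= j < s.+1)
    gap j * inner (u j - eigenprojection uh d (u j)) (u j).
  apply: cvg_big => [|j _]; first exact: add_continuous.
  apply: cvgM; [exact: cvg_cst|exact: residual_cvg].
apply: (ler_cvg_to Gcvg (cvg_cst _)); exact: nearW.
Qed.

End residual_bound.

(** * Reconstruction error *)

Section nonneg_series.
Local Open Scope ereal_scope.
Context {R : realType}.

Lemma eseries_condT (f : nat -> \bar R) (Q : pred nat) m :
  \sum_(m <= i <oo | Q i) f i =
  \sum_(i <oo) (if Q i && (m <= i)%N then f i else 0).
Proof. by rewrite eseries_cond eseries_mkcond. Qed.

Context {d : measure_display} {T : measurableType d}.
Variables (Q : pred nat) (h : nat -> T -> \bar R).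
Hypothesis h_ge0 : forall k w, Q k -> 0 <= h k w.
Hypothesis mh : forall k, Q k -> measurable_fun [set: T] (h k).

(** Extension by zero, which turns a guarded series starting at [m] into an unguarded one starting
    at 0. *)
Let h' m k w := if Q k && (m <= k)%N then h k w else 0.

Let h'_ge0 m k w : 0 <= h' m k w.
Proof. by rewrite /h'; case: ifPn => // /andP[Qk _]; exact: h_ge0. Qed.

Let mh' m k : measurable_fun [set: T] (h' m k).
Proof.
rewrite /h'; case: (boolP (Q k && (m <= k)%N)) => [/andP[Qk _]|_]; first exact: mh.
exact: measurable_cst.
Qed.

Lemma measurable_nneseries m :
  measurable_fun [set: T] (fun w => \sum_(m <= k <oo | Q k) h k w).
Proof.
rewrite (_ : (fun w => _) = (fun w => \sum_(k <oo) h' m k w)); last first.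
  by apply/funext => w; rewrite eseries_condT.
have := @ge0_emeasurable_sum _ T R setT (h' m) xpredT.
by apply=> [k w _ _|k _]; [exact: h'_ge0|exact: mh'].
Qed.

Lemma integral_nneseries_cond (mu : {measure set T -> \bar R}) m :
  \int[mu]_w \sum_(m <= k <oo | Q k) h k w =
  \sum_(m <= k <oo | Q k) \int[mu]_w h k w.
Proof.
transitivity (\int[mu]_w \sum_(k <oo) h' m k w).
  by apply: eq_integral => w _; rewrite eseries_condT.
rewrite (integral_nneseries mu measurableT (mh' m)) // [RHS]eseries_condT.
by apply: eq_eseriesr => k _; rewrite /h'; case: ifP => // _; rewrite integral0.
Qed.

End nonneg_series.

(** * Tails of the trace *)

Section trace_tails.
Local Open Scope ereal_scope.
Context {R : realType}.
Variables (p : option nat) (lam : nat -> R).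
Hypothesis lam_gt0 : forall j, in_dim p j -> (0 < lam j)%R.

Lemma trace_gt_ge0 r : 0 <= trace_gt p lam r.
Proof. by apply: nneseries_ge0 => j _ pj; rewrite lee_fin ltW // lam_gt0. Qed.

(** The value [s = 0] is listed apart because 0 is never an index of the dimension. *)
Lemma trace_gt_split r s : (r <= s)%N -> in_dim p s || (s == 0)%N ->
  trace_gt p lam r = (\sum_(r.+1 <= j < s.+1) lam j)%:E + trace_gt p lam s.
Proof.
move=> rs ps; rewrite /trace_gt (nneseries_split_cond _ (s - r)); last first.
  by move=> k pk; rewrite lee_fin ltW // lam_gt0.
rewrite addSn subnKC //; congr (_ + _).
rewrite -sumEFin; case/orP: ps => [ps|/eqP s0]; first by rewrite -(big_in_dim _ _ ps).
by rewrite s0 !big_geq.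
Qed.

End trace_tails.

(** * The reconstruction error in the eigenbasis *)

Section reconstruction.
Context {R : realType} {H : separableHilbertType R}.
Variables (p : option nat) (S : H -> H) (lam : nat -> R) (u : nat -> H).
Hypotheses (eS : eigendecomposition p S lam u) (sS : self_adjoint S).
Hypothesis lam_gt0 : forall j, in_dim p j -> 0 < lam j.

Lemma trace_eigen : trace p u S = trace_gt p lam 0.
Proof.
have [onb Su _] := eS; apply: eq_eseriesr => j pj; congr EFin.
by rewrite Su // innerZl (onb_inner onb) // eqxx mulr1.
Qed.

Lemma reconstruction_error_eigen (Q : H -> H) :
  reconstruction_error p u S Q =
  (\sum_(1 <= j <oo | in_dim p j) (lam j * inner (u j - Q (u j)) (u j))%:E)%E.
Proof.
have [onb Su _] := eS; apply: eq_eseriesr => j pj; congr EFin.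
by rewrite sS Su // innerZr.
Qed.

Variables (uh : nat -> H) (d : nat).
Hypotheses (onbh : orthonormal_basis p uh) (pd : in_dim p d).

Let h j : R := inner (u j - eigenprojection uh d (u j)) (u j).
Let h_ge0 j : 0 <= h j. Proof. exact: (residual_ge0 onbh). Qed.
Let h_le1 j : in_dim p j -> h j <= 1.
Proof.
move=> pj; rewrite /h; apply: le_trans (residual_le uh d (u j)) _.
by have [onb _ _] := eS; rewrite (onb_inner onb) // eqxx.
Qed.

Lemma reconstruction_error_ge0 :
  (0 <= reconstruction_error p u S (eigenprojection uh d))%E.
Proof.
rewrite reconstruction_error_eigen; apply: nneseries_ge0 => j _ pj.
by rewrite lee_fin mulr_ge0 ?h_ge0 // ltW // lam_gt0.
Qed.

(** Beyond [s] each squared residual is at most 1. The case [s = 0] is the trivial bound by the full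
    trace, used on the exceptional events. *)
Lemma reconstruction_error_le s : in_dim p s || (s == 0)%N ->
  (reconstruction_error p u S (eigenprojection uh d) <=
  (\sum_(1 <= j < s.+1) lam j *
      inner (u j - eigenprojection uh d (u j)) (u j))%:E
  + trace_gt p lam s)%E.
Proof.
move=> ps; rewrite reconstruction_error_eigen (nneseries_split_cond _ s); last first.
  by move=> j pj; rewrite lee_fin mulr_ge0 ?h_ge0 // ltW // lam_gt0.
rewrite add1n; apply: leeD.
  rewrite -sumEFin le_eqVlt; apply/orP; left; apply/eqP.
  by case/orP: ps => [ps|/eqP->]; [rewrite -(big_in_dim _ _ ps)|rewrite !big_geq].
apply: lee_nneseries => j pj.
  by move=> pj'; rewrite lee_fin mulr_ge0 ?h_ge0 // ltW // lam_gt0.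
by rewrite lee_fin ler_piMr ?h_le1 // ltW // lam_gt0.
Qed.

Lemma reconstruction_error_le_trace :
  (reconstruction_error p u S (eigenprojection uh d) <= trace_gt p lam 0)%E.
Proof.
have := @reconstruction_error_le 0 (orbT _).
by rewrite big_geq // add0e.
Qed.

End reconstruction.

(** In the eigenbasis the error is a series of nonnegative terms, each measurable because the
    projection of each fixed [u j] is a random vector. *)
Lemma measurable_reconstruction_error {R : realType} {H : separableHilbertType R}
    {disp : measure_display} {T : measurableType disp} p (S : H -> H) lam u
    (uhat : T -> nat -> H) d :
  eigendecomposition p S lam u -> self_adjoint S ->
  (forall j, in_dim p j -> 0 < lam j) ->
  (forall w, orthonormal_basis p (uhat w)) -> in_dim p d ->
  (forall x, random_vector (fun w => eigenprojection (uhat w) d x)) ->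
  measurable_fun setT
    (fun w => reconstruction_error p u S (eigenprojection (uhat w) d)).
Proof.
move=> eS sS lam_gt0 onbh pd mproj.
under eq_fun do rewrite (reconstruction_error_eigen eS sS).
apply: measurable_nneseries => [j w pj|j _].
  by rewrite lee_fin mulr_ge0 ?(residual_ge0 (onbh w)) // ltW // lam_gt0.
apply/measurable_EFinP; apply: measurable_funM => //.
under eq_fun do rewrite innerBl.
by apply: measurable_funB => //; exact: measurable_inner.
Qed.

(** The function t / (t - m) = 1 + m / (t - m) decreases for t > m. *)
Lemma ratio_gap_le {R : realFieldType} (a b m : R) :
  0 < m -> m < b -> b <= a -> a / (a - m) <= b / (b - m).
Proof.
move=> m0 mb ba; have bm : 0 < b - m by lra.
have am : 0 < a - m by lra.
by rewrite ler_pdivrMr // mulrAC ler_pdivlMr //; nra.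
Qed.

(** * Expected reconstruction error *)

Section high_probability_events.
Context {R : realType} {H : separableHilbertType R}.
Context {disp : measure_display} {T : measurableType disp} (P : probability T R).
Variables (C1 C3 : R) (p : option nat) (X : T -> H) (S : H -> H) (lam : nat -> R)
  (u : nat -> H) (n : nat) (Xs : 'I_n -> T -> H) (lamhat : T -> nat -> R)
  (uhat : T -> nat -> H) (d s : nat).
Hypotheses (C3_gt1 : 1 < C3) (KL : koltchinskii_lounici C1 C3).
Hypotheses (mX : random_vector X) (cX : centered P X) (sX : subgaussian P C1 X)
  (cS : is_covariance P X S) (eS : eigendecomposition p S lam u)
  (lam_gt0 : forall j, in_dim p j -> 0 < lam j)
  (n_gt0 : (1 <= n)%N) (iX : independent_copies P X Xs).
Hypotheses (eSh : forall w, eigendecomposition p (sample_covariance Xs w)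
    (lamhat w) (uhat w)) (pd : in_dim p d.+1) (sd : (1 <= s <= d)%N).

Local Notation mu := (lam d.+1).
Local Notation gap j := (lam j - mu).
Hypothesis gap_gt0 : 0 < gap s.

Let onb : orthonormal_basis p u. Proof. by case: eS. Qed.
Let pd' : in_dim p d.
Proof.
by case/andP: sd => s0 sd'; apply: in_dim_le pd; rewrite (leq_trans s0 sd') leqnSn.
Qed.
Let ps : in_dim p s.
Proof. by case/andP: sd => s0 sd'; apply: in_dim_le pd; rewrite s0 leqW. Qed.
Let mu_gt0 : 0 < mu. Proof. exact: lam_gt0. Qed.
Let C3_gt0 : 0 < C3. Proof. exact: lt_trans C3_gt1. Qed.

(** Concentration for the projection of X beyond [d], whose covariance has largest eigenvalue [mu].
    The value of [x] makes C3 mu x equal to half the gap, and Courant-Fischer converts the norm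
    bound into an eigenvalue bound. *)
Lemma tail_event (x : R) : x = gap s / (2 * C3 * mu) ->
  (trace_gt p lam d <= (n%:R * mu * Num.min x (x ^+ 2))%:E)%E ->
  exists A : set T, [/\ measurable A,
    (P A <= (expR (- (n%:R * Num.min x (x ^+ 2))))%:E)%E &
    forall w, ~ A w -> lamhat w d.+1 <= mu + gap s / 2].
Proof.
move=> xE tr_le; pose delta j : R := if (j <= d)%N then 0 else 1.
pose D (v : H) := v - eigenprojection u d v.
have x_gt0 : 0 < x by rewrite xE divr_gt0 // !mulr_gt0.
have [_ _ dec] := eS.
have delta_d : delta d.+1 ^+ 2 * lam d.+1 = mu by rewrite /delta ltnn expr1n mul1r.
have [||||||||A [mA PA hA]] := @concentration_event _ _ _ _ P p X S lam u n Xs C1 C3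
    C3_gt1 KL mX cX sX cS eS lam_gt0 n_gt0 iX D delta d.+1 x.
- exact: bounded_operator_residual.
- exact: residual_self_adjoint.
- by move=> j pj; exact: (residual_basis onb pd' pj).
- exact: pd.
- by rewrite /delta ltnn.
- move=> j pj; rewrite delta_d /delta; case: leqP => jd.
    by rewrite expr0n mul0r ltW.
  by rewrite expr1n mul1r dec.
- exact: x_gt0.
- rewrite delta_d; apply: le_trans tr_le.
  rewrite (nneseries_split_cond _ d) => [|j pj]; last first.
    by rewrite lee_fin mulr_ge0 ?sqr_ge0 // ltW // lam_gt0.
  rewrite add1n big_nat_cond big1 ?add0e => [|j /andP[/andP[_ jd] _]]; last first.
    by rewrite /delta -ltnS jd expr0n mul0r.
  rewrite le_eqVlt; apply/orP; left; apply/eqP.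
  rewrite /trace_gt eseries_cond [RHS]eseries_cond; apply: eq_eseriesr => j.
  by move=> /andP[_ dj]; rewrite /delta leqNgt dj expr1n mul1r.
exists A; split=> // w /hA {}hA.
apply: (eigenvalue_le_residual eS _ (eSh w)) => //.
- exact: covariance_self_adjoint cS.
- by case: (bounded_operator_sample_covariance Xs w).
- move=> v; apply: le_trans (hA v) _; rewrite delta_d le_eqVlt; apply/orP; left.
  by apply/eqP; rewrite xE; field; rewrite !gt_eqF.
Qed.

Let ge_s j : (1 <= j <= s)%N -> lam s <= lam j.
Proof.
move=> js; have [_ _ dec] := eS; have /andP[_ js'] := js.
by apply: dec => //; exact: in_dim_le ps.
Qed.

Let gap_j j : (1 <= j <= s)%N -> 0 < gap j.
Proof. by move=> js; apply: lt_le_trans gap_gt0 _; rewrite lerB // ge_s. Qed.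

Lemma relative_gap_le j : (1 <= j <= s)%N -> lam j / gap j <= lam s / gap s.
Proof.
by move=> js; apply: ratio_gap_le; [exact: mu_gt0|rewrite -subr_gt0|exact: ge_s].
Qed.

(** Concentration for A X, whose covariance has the nonzero eigenvalues lam_j / g_j with j <= s, the
    largest being at j = s. The value of [x] makes C3 (lam_s / g_s) x equal to 1/4. *)
Lemma whitened_event (x : R) : x = gap s / lam s / (4 * C3) ->
  lam s / gap s * (\sum_(1 <= j < s.+1) lam j / gap j) <= n%:R / (16 * C3 ^+ 2) ->
  exists A : set T, [/\ measurable A,
    (P A <= (expR (- (n%:R * x ^+ 2)))%:E)%E &
    forall w, ~ A w -> forall v,
      let D := diag_operator u (fun j => (Num.sqrt (gap j))^-1) s in
      `|D (S (D v) - sample_covariance Xs w (D v))| <= 4^-1 * `|v|].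
Proof.
move=> xE hyp.
pose delta j : R := if (j <= s)%N then (Num.sqrt (gap j))^-1 else 0.
pose D := diag_operator u (fun j => (Num.sqrt (gap j))^-1) s.
have ls0 : 0 < lam s by exact: lam_gt0.
have x_gt0 : 0 < x by rewrite xE !divr_gt0 // mulr_gt0.
have x_le1 : x <= 1.
  have c1 := C3_gt1; have m0 := mu_gt0.
  rewrite xE ler_pdivrMr ?mulr_gt0 // mul1r (@le_trans _ _ 1) //; last lra.
  by rewrite ler_pdivrMr // mul1r; lra.
have minx : Num.min x (x ^+ 2) = x ^+ 2.
  by apply/min_idPr; rewrite expr2 ler_piMl // ltW.
have deltaE j : (1 <= j <= s)%N -> delta j ^+ 2 * lam j = lam j / gap j.
  move=> js; have /andP[_ js'] := js.
  by rewrite /delta js' exprVn sqr_sqrtr ?ltW ?gap_j // mulrC.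
have ss : (1 <= s <= s)%N by rewrite leqnn andbT; case/andP: sd.
have [||||||||A [mA PA hA]] := @concentration_event _ _ _ _ P p X S lam u n Xs C1 C3
    C3_gt1 KL mX cX sX cS eS lam_gt0 n_gt0 iX D delta s x.
- exact: diag_operator_bounded.
- exact: diag_operator_self_adjoint.
- by move=> j pj; exact: (diag_operator_basis onb _ ps pj).
- exact: ps.
- by rewrite /delta leqnn invr_gt0 sqrtr_gt0.
- move=> j pj; rewrite (deltaE s ss); case: (leqP j s) => js.
    have js' : (1 <= j <= s)%N by rewrite js andbT; case/andP: pj.
    by rewrite deltaE // relative_gap_le.
  by rewrite /delta leqNgt js expr0n mul0r divr_ge0 // ltW.
- exact: x_gt0.
- rewrite (deltaE s ss) minx.
  rewrite (nneseries_split_cond _ s) => [|j pj]; last first.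
    by rewrite lee_fin mulr_ge0 ?sqr_ge0 // ltW // lam_gt0.
  rewrite add1n [X in (_ + X)%E](_ : _ = 0)%E ?adde0; last first.
    apply: eseries0 => j sj _; by rewrite /delta leqNgt sj expr0n mul0r.
  rewrite -(big_in_dim _ _ ps) sumEFin lee_fin.
  rewrite (eq_big_nat _ _ (F2 := fun j => lam j / gap j)) => [|j]; last first.
    by rewrite ltnS => js; exact: deltaE.
  (* Multiplied by this ratio, the trace condition becomes exactly [hyp]. *)
  have r0 : 0 < lam s / gap s by rewrite divr_gt0.
  rewrite -(ler_pM2l r0); apply: le_trans hyp _.
  rewrite le_eqVlt; apply/orP; left; apply/eqP; rewrite xE; field.
  by rewrite !gt_eqF.
exists A; split=> //; first by rewrite minx in PA.
move=> w /hA {}hA v; apply: le_trans (hA v) _.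
rewrite (deltaE s ss) le_eqVlt; apply/orP; left; apply/eqP.
by congr (_ * _); rewrite xE; field; rewrite !gt_eqF.
Qed.

End high_probability_events.

Lemma eseries_cvg {R : realType} (f : nat -> R) (Q : pred nat) m (r : R) :
  (fun N => \sum_(m <= l < N.+1 | Q l) f l) @ \oo --> r ->
  (\sum_(m <= l <oo | Q l) (f l)%:E = r%:E)%E.
Proof.
move=> fr; apply/cvg_lim => //; apply/fine_cvgP; split.
  by apply: nearW => N; rewrite sumEFin.
rewrite -cvg_shiftS; apply: cvg_trans fr; apply: near_eq_cvg; apply: nearW => N.
by rewrite /= sumEFin.
Qed.

(** * Integration of the error over the good and exceptional events *)

Section expected_reconstruction_error.
Context {R : realType} {H : separableHilbertType R}.
Context {disp : measure_display} {T : measurableType disp} (P : probability T R).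
Variables (C1 C3 : R) (p : option nat) (X : T -> H) (S : H -> H) (lam : nat -> R)
  (u : nat -> H) (n : nat) (Xs : 'I_n -> T -> H) (lamhat : T -> nat -> R)
  (uhat : T -> nat -> H) (d s : nat).
Hypotheses (C3_gt1 : 1 < C3) (KL : koltchinskii_lounici C1 C3).
Hypotheses (mX : random_vector X) (cX : centered P X) (sX : subgaussian P C1 X)
  (cS : is_covariance P X S) (eS : eigendecomposition p S lam u)
  (lam_gt0 : forall j, in_dim p j -> 0 < lam j)
  (n_gt0 : (1 <= n)%N) (iX : independent_copies P X Xs).
Hypotheses (eSh : forall w, eigendecomposition p (sample_covariance Xs w)
    (lamhat w) (uhat w)) (pd : in_dim p d.+1) (sd : (1 <= s <= d)%N).
Hypothesis mproj : forall x, random_vector (fun w => eigenprojection (uhat w) d x).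

Local Notation mu := (lam d.+1).
Local Notation gap j := (lam j - mu).
Hypothesis gap_gt0 : 0 < gap s.

Let onb : orthonormal_basis p u. Proof. by case: eS. Qed.
Let pd' : in_dim p d.
Proof.
by case/andP: sd => s0 sd'; apply: in_dim_le pd; rewrite (leq_trans s0 sd') leqnSn.
Qed.
Let ps : in_dim p s.
Proof. by case/andP: sd => s0 sd'; apply: in_dim_le pd; rewrite s0 leqW. Qed.
Let pj j : (1 <= j <= s)%N -> in_dim p j.
Proof. by move=> h; exact: in_dim_le ps. Qed.
Let sS : self_adjoint S. Proof. exact: covariance_self_adjoint cS. Qed.
Let gap_j j : (1 <= j <= s)%N -> 0 < gap j.
Proof.
move=> js; apply: lt_le_trans gap_gt0 _; rewrite lerB //.
have [_ _ dec] := eS; have /andP[_ js'] := js.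
by apply: dec => //; exact: pj.
Qed.

Let cross j l w := (inner (sample_covariance Xs w (u j)) (u l) ^+ 2)%:E.

(* The squared Hilbert-Schmidt norm of P_{>s} (hat Sigma) A in the notation of the
   header. *)
Let noise w := (\sum_(1 <= j < s.+1)
  ((gap j)^-1)%:E * \sum_(s.+1 <= l <oo | in_dim p l) cross j l w)%E.

Let cross_ge0 j l w : (0 <= cross j l w)%E.
Proof. by rewrite lee_fin sqr_ge0. Qed.

Let mcross j l : measurable_fun setT (cross j l).
Proof.
apply/measurable_EFinP; apply: measurable_funX.
by apply: measurable_sample_covariance; case: iX.
Qed.

Let noise_ge0 w : (0 <= noise w)%E.
Proof.
rewrite /noise big_nat_cond; apply: sume_ge0 => j /andP[/andP[j0 js] _].
apply: mule_ge0; last by apply: nneseries_ge0 => l _ _; exact: cross_ge0.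
by rewrite lee_fin invr_ge0 ltW // gap_j // j0.
Qed.

Let mnoise : measurable_fun setT noise.
Proof.
apply: emeasurable_sum => j; apply: measurable_funeM.
by apply: measurable_nneseries => l *; [exact: cross_ge0|exact: mcross].
Qed.

Variable tau : R.
Hypothesis tauE : trace_gt p lam s = tau%:E.

(** Tonelli reduces the claim to single entries with j <= s < l, hence distinct indices, where the
    variance bound applies; summing lam_l over l > s gives [tau]. *)
Lemma noise_expectation :
  (\int[P]_w noise w <=
    (16 * C1 ^+ 4 / n%:R * (\sum_(1 <= j < s.+1) lam j / gap j) * tau)%:E)%E.
Proof.
have i0 j : (1 <= j <= s)%N -> 0 <= (gap j)^-1.
  by move=> js; rewrite invr_ge0 ltW // gap_j.
pose ser j w := (\sum_(s.+1 <= l <oo | in_dim p l) cross j l w)%E.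
(* Outside 1 <= j <= s the gap may be negative, so the summand is cut to zero there to be
   nonnegative for every [j]. *)
pose F j w := if (1 <= j <= s)%N then (((gap j)^-1)%:E * ser j w)%E else 0%E.
have noiseE w : noise w = (\sum_(1 <= j < s.+1) F j w)%E.
  by apply: eq_big_nat => j; rewrite ltnS /F => ->.
have mser j : measurable_fun setT (ser j).
  by apply: measurable_nneseries => l *; [exact: cross_ge0|exact: mcross].
have ser0 j w : (0 <= ser j w)%E.
  by apply: nneseries_ge0 => l _ _; exact: cross_ge0.
have -> : (\int[P]_w noise w = \sum_(1 <= j < s.+1) \int[P]_w F j w)%E.
  under eq_integral do rewrite noiseE.
  rewrite ge0_integral_sum // => [j|j w _]; rewrite /F;
    case: (boolP (1 <= j <= s)%N) => // js.
    exact: measurable_funeM.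
  by apply: mule_ge0 => //; rewrite lee_fin i0.
pose c := 16 * C1 ^+ 4 / n%:R.
have c0 : 0 <= c by rewrite /c divr_ge0 // mulr_ge0 // exprn_even_ge0.
rewrite -/c mulr_sumr mulr_suml -sumEFin big_nat [leRHS]big_nat.
apply: lee_sum => j; rewrite ltnS => js.
have -> : (\int[P]_w F j w = ((gap j)^-1)%:E * \int[P]_w ser j w)%E.
  by rewrite /F js ge0_integralZl_EFin // i0.
rewrite (_ : c * _ * _ = (gap j)^-1 * (c * lam j * tau)); last by ring.
rewrite EFinM lee_wpmul2l ?lee_fin ?i0 //.
rewrite /ser integral_nneseries_cond => [|l w _|l _]; last 2 first.
- exact: cross_ge0.
- exact: mcross.
rewrite EFinM -tauE -nneseriesZl => [|l pl]; last by rewrite lee_fin ltW // lam_gt0.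
rewrite eseries_cond [leRHS]eseries_cond; apply: lee_nneseries => l.
  by move=> _ _; apply: integral_ge0.
move=> /andP[pl sl]; rewrite -EFinM.
rewrite (_ : c * lam j * lam l = 16 * C1 ^+ 4 * lam j * lam l / n%:R); last first.
  by rewrite /c; ring.
apply: (sample_covariance_eigen_variance mX iX n_gt0 sX cS eS) => //.
- exact: pj.
- by rewrite neq_ltn; have /andP[_ /leq_ltn_trans ->] := js.
- by apply: lam_gt0; exact: pj.
- exact: lam_gt0.
Qed.

(** For j <= s, lam_j <= (lam_s / g_s) g_j, so the leading part of the error is controlled by the
    gap-weighted bound, whose right-hand side is [noise] by Parseval. *)
Lemma reconstruction_error_noise_le w :
  lamhat w d.+1 <= mu + gap s / 2 ->
  (forall v, let D := diag_operator u (fun j => (Num.sqrt (gap j))^-1) s in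
    `|D (S (D v) - sample_covariance Xs w (D v))| <= 4^-1 * `|v|) ->
  (reconstruction_error p u S (eigenprojection (uhat w) d) <=
    tau%:E + (16 * (lam s / gap s))%:E * noise w)%E.
Proof.
move=> hlam hwhite; have onbh : orthonormal_basis p (uhat w) by case: (eSh w).
have sSh := sample_covariance_self_adjoint Xs w.
have -> : noise w = (\sum_(1 <= j < s.+1) (gap j)^-1 *
    inner (sample_covariance Xs w (u j) -
      eigenprojection u s (sample_covariance Xs w (u j)))
      (sample_covariance Xs w (u j)))%:E.
  rewrite -sumEFin; apply: eq_bigr => j _; rewrite EFinM; congr (_ * _)%E.
  by apply: eseries_cvg; exact: residual_cvg.
rewrite -EFinM -tauE addeC.
apply: le_trans (reconstruction_error_le eS sS lam_gt0 onbh pd' (s := s) _) _.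
  by rewrite ps.
apply: leeD => //; rewrite lee_fin.
have hw := weighted_residual_bound eS sS (eSh w) sSh pd sd gap_gt0 hlam hwhite.
have r0 : 0 <= lam s / gap s by rewrite divr_ge0 // ltW // lam_gt0.
rewrite -[leRHS]mulrA [leRHS]mulrCA; apply: le_trans (ler_wpM2l r0 hw).
rewrite mulr_sumr big_nat [leRHS]big_nat; apply: ler_sum => j; rewrite ltnS => js.
rewrite mulrA ler_wpM2r //; first exact: (residual_ge0 onbh).
rewrite -ler_pdivrMr ?gap_j //.
exact: (relative_gap_le eS lam_gt0 pd sd gap_gt0).
Qed.

(** Off the two exceptional events the noise bound holds; on each of them the error is at most the
    full trace [t], which produces the factor 2 before the exponential. *)
Lemma expected_reconstruction_error_le (x t : R) : x = gap s / (2 * C3 * mu) ->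
  (trace_gt p lam d <= (n%:R * mu * Num.min x (x ^+ 2))%:E)%E ->
  lam s / gap s * (\sum_(1 <= j < s.+1) lam j / gap j) <= n%:R / (16 * C3 ^+ 2) ->
  trace_gt p lam 0 = t%:E ->
  (\int[P]_w reconstruction_error p u S (eigenprojection (uhat w) d) <=
   ((1 + 16 * C1 ^+ 4) * tau +
     2 * t * expR (- (n%:R * gap s ^+ 2 / (4 * C3 * lam s) ^+ 2)))%:E)%E.
Proof.
move=> xE tail hyp tE; set E := expR _.
have C3_1 := C3_gt1; have gs := gap_gt0.
have mu_gt0 : 0 < mu by exact: lam_gt0.
have ls_gt0 : 0 < lam s by exact: lam_gt0.
have C3_gt0 : 0 < C3 by lra.
have t0 : 0 <= t by rewrite -lee_fin -tE trace_gt_ge0.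
have tau0 : 0 <= tau by rewrite -lee_fin -tauE trace_gt_ge0.
have [A1 [mA1 PA1 hA1]] := tail_event C3_gt1 KL mX cX sX cS eS lam_gt0 n_gt0 iX
  eSh pd sd gap_gt0 xE tail.
pose y := gap s / lam s / (4 * C3).
have [A2 [mA2 PA2 hA2]] := whitened_event C3_gt1 KL mX cX sX cS eS lam_gt0 n_gt0 iX
  pd sd gap_gt0 (erefl y) hyp.
have yE : n%:R * gap s ^+ 2 / (4 * C3 * lam s) ^+ 2 = n%:R * y ^+ 2.
  by rewrite /y; field; rewrite !gt_eqF.
have {}PA2 : (P A2 <= E%:E)%E by apply: le_trans PA2 _; rewrite /E yE.
(* Here x = y (2 lam_s / mu) >= y and y <= 1, so y^2 is at most both x and x^2: the tail event obeys
   the same exponential bound. *)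
have {}PA1 : (P A1 <= E%:E)%E.
  apply: le_trans PA1 _; rewrite lee_fin ler_expR lerN2 yE ler_wpM2l //.
  have y0 : 0 < y by rewrite !divr_gt0 // mulr_gt0.
  have y1 : y <= 1.
    rewrite /y ler_pdivrMr ?mulr_gt0 // mul1r (@le_trans _ _ 1) //; last lra.
    by rewrite ler_pdivrMr // mul1r; lra.
  have yx : y <= x.
    have -> : x = y * (2 * lam s / mu) by rewrite xE /y; field; rewrite !gt_eqF.
    apply: ler_peMr; first exact: ltW.
    by rewrite ler_pdivlMr // mul1r; lra.
  rewrite le_min lerXn2r ?nnegrE ?(ltW y0) ?(le_trans (ltW y0) yx) // andbT.
  by apply: le_trans yx; rewrite expr2 ler_piMr // ltW.
pose K := 16 * (lam s / gap s).
have K0 : 0 <= K by rewrite mulr_ge0 // divr_ge0 // ltW.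
pose f w := (tau%:E + K%:E * noise w + t%:E * (\1_A1 w)%:E + t%:E * (\1_A2 w)%:E)%E.
have m1 (A : set T) : measurable A -> measurable_fun setT (fun w => (\1_A w : R)%:E).
  by move=> mA; apply/measurable_EFinP; exact: measurable_indic.
have ind0 (A : set T) w : (0 <= t%:E * (\1_A w : R)%:E)%E.
  by rewrite -EFinM lee_fin mulr_ge0.
have base0 w : (0 <= tau%:E + K%:E * noise w)%E.
  by rewrite adde_ge0 ?mule_ge0 ?lee_fin.
have mbase : measurable_fun setT (fun w => tau%:E + K%:E * noise w)%E.
  by apply: emeasurable_funD => //; exact: measurable_funeM.
have Rf w : (reconstruction_error p u S (eigenprojection (uhat w) d) <= f w)%E.
  have onbh : orthonormal_basis p (uhat w) by case: (eSh w).
  have Rt : (reconstruction_error p u S (eigenprojection (uhat w) d) <= t%:E)%E.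
    by rewrite -tE; exact: reconstruction_error_le_trace.
  have [A1w|nA1w] := pselect (A1 w).
    rewrite /f indicE mem_set //= mule1; apply: le_trans Rt _.
    by rewrite addeAC leeDr // adde_ge0.
  have [A2w|nA2w] := pselect (A2 w).
    rewrite /f [in X in (_ <= _ + X)%E]indicE mem_set //= mule1; apply: le_trans Rt _.
    by rewrite leeDr // adde_ge0.
  have := reconstruction_error_noise_le (hA1 w nA1w) (hA2 w nA2w).
  by rewrite -/K /f !indicE !memNset //= mule0 !adde0.
have mR : measurable_fun setT
    (fun w => reconstruction_error p u S (eigenprojection (uhat w) d)).
  apply: (measurable_reconstruction_error eS) => // w.
  by case: (eSh w).
apply: (@le_trans _ _ (\int[P]_w f w)%E).
  apply: ge0_le_integral => //.
  - move=> w _; have onbh : orthonormal_basis p (uhat w) by case: (eSh w).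
    exact: (reconstruction_error_ge0 eS sS lam_gt0 onbh).
  - by apply: emeasurable_funD; [apply: emeasurable_funD => //|];
      apply: measurable_funeM; exact: m1.
have intA (A : set T) : measurable A -> (\int[P]_w (t%:E * (\1_A w)%:E) = t%:E * P A)%E.
  move=> mA; rewrite ge0_integralZl_EFin ?integral_indic ?setIT //.
  exact: m1.
rewrite /f ge0_integralD //; last 3 first.
- by move=> w _; rewrite adde_ge0.
- by apply: emeasurable_funD => //; apply: measurable_funeM; exact: m1.
- by apply: measurable_funeM; exact: m1.
rewrite ge0_integralD //; last by apply: measurable_funeM; exact: m1.
rewrite ge0_integralD //; last 2 first.
- by move=> w _; rewrite mule_ge0 ?lee_fin.
- exact: measurable_funeM.
rewrite !intA // ge0_integralZl_EFin //.
rewrite (_ : \int[P]_w tau%:E = tau%:E)%E; last first.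
  by rewrite integral_cst //= probability_setT mule1.
have hK := lee_wpmul2l (_ : 0 <= K%:E)%E noise_expectation.
have hA (A : set T) : (P A <= E%:E)%E -> (t%:E * P A <= (t * E)%:E)%E.
  by move=> PA; rewrite EFinM lee_wpmul2l ?lee_fin.
apply: (le_trans (leeD (leeD (leeD (lexx _) (hK _)) (hA _ PA1)) (hA _ PA2))).
  by rewrite lee_fin.
rewrite -EFinM -!EFinD lee_fin.
pose q := \sum_(1 <= j < s.+1) lam j / gap j; pose r := lam s / gap s.
rewrite -/q; rewrite -/q -/r in hyp.
have n0 : (0 : R) < n%:R by rewrite ltr0n.
have C1_ge0 : 0 <= C1 ^+ 4 by rewrite exprn_even_ge0.
(* By [hyp], 16 r q is at most n / C3^2, hence at most n as C3 > 1. *)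
have noise_coef : K * (16 * C1 ^+ 4 / n%:R * q * tau) <= 16 * C1 ^+ 4 * tau.
  rewrite (_ : K * _ = 16 * C1 ^+ 4 * tau * (16 * (r * q) / n%:R)); last first.
    by rewrite /K -/r; ring.
  apply: ler_piMr; first by rewrite mulr_ge0 // mulr_ge0.
  rewrite ler_pdivrMr // mul1r.
  have c16 : 0 < 16 * C3 ^+ 2 by rewrite mulr_gt0 // exprn_gt0.
  move: hyp; rewrite ler_pdivlMr // => hyp.
  have c1 : 1 <= C3 ^+ 2 by rewrite exprn_ege1 // ltW.
  have [rq0|/ltW rq0] := leP 0 (r * q); last by apply: (@le_trans _ _ 0); [nra|exact: ltW].
  apply: le_trans hyp; nra.
rewrite (_ : (1 + 16 * C1 ^+ 4) * tau + 2 * t * E =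
  tau + 16 * C1 ^+ 4 * tau + t * E + t * E); last by ring.
by rewrite !lerD2r lerD2l.
Qed.

End expected_reconstruction_error.

(** * Choice of the index r and conclusion *)

Lemma exists_last_index (good : nat -> Prop) s :
  exists r, [/\ (r <= s)%N, (0 < r)%N -> good r &
    forall j, (r < j <= s)%N -> ~ good j].
Proof.
elim: s => [|s [r [rs gr ngr]]].
  by exists 0%N; split=> // j /andP[j0]; rewrite leqNgt j0.
have [gs|ngs] := pselect (good s.+1).
  by exists s.+1; split=> // j /andP[sj]; rewrite leqNgt sj.
exists r; split=> // [|j /andP[rj]]; first exact: leqW.
by rewrite leq_eqVlt => /predU1P[->//|js]; apply: ngr; rewrite rj.
Qed.

(* If the trace condition of the concentration inequality fails at r + 1, then
   tr_{>d} exceeds the right-hand side, hence the sum of the block. *)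
Lemma block_sum_le {R : realType} (lam : nat -> R) (n m C3 x : R) r s :
  (forall i j, (1 <= i <= j)%N -> (j <= s)%N -> lam j <= lam i) ->
  0 < m -> m < lam s -> 1 < C3 -> 0 <= n -> (r < s)%N ->
  lam s / (lam s - m) * (\sum_(1 <= j < s.+1) lam j / (lam j - m))
    <= n / (16 * C3 ^+ 2) ->
  x = (lam r.+1 - m) / (2 * C3 * m) ->
  \sum_(r.+1 <= j < s.+1) lam j <= n * m * Num.min x (x ^+ 2).
Proof.
move=> dec m0 ms C31 n0 rs hyp xE.
have s0 : (0 < s)%N by exact: leq_ltn_trans rs.
pose g := lam r.+1 - m; pose L := \sum_(r.+1 <= j < s.+1) lam j.
have lams j : (1 <= j <= s)%N -> lam s <= lam j.
  by move=> /andP[j1 js]; apply: dec; rewrite ?j1.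
have lr : lam s <= lam r.+1 by apply: lams.
have g0 : 0 < g by rewrite /g; lra.
have ratio : lam r.+1 / g <= lam s / (lam s - m) by exact: ratio_gap_le.
(* For r < j <= s the gap of [j] is at most [g], so lam_j / g is at most lam_j / (lam_j - m); the
   terms up to [r] are nonnegative. *)
have Lg : L / g <= \sum_(1 <= j < s.+1) lam j / (lam j - m).
  rewrite (@big_cat_nat _ _ _ r.+1) //=; last by rewrite ltnS ltnW.
  apply: (@le_trans _ _ (\sum_(r.+1 <= j < s.+1) lam j / (lam j - m))); last first.
    rewrite lerDr big_nat sumr_ge0 // => j /andP[j1 jr].
    have ljs : lam s <= lam j.
      by apply: lams; rewrite j1 (leq_trans _ rs) // ltnW.
    by apply: divr_ge0; lra.
  rewrite /L mulr_suml big_nat [leRHS]big_nat; apply: ler_sum => j /andP[rj].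
  rewrite ltnS => js; have ljs := lams j _; have ljr := dec r.+1 j _ js.
  have {}ljs : lam s <= lam j by apply: ljs; rewrite js andbT (leq_trans _ rj).
  have {}ljr : lam j <= lam r.+1 by apply: ljr; rewrite rj.
  have lj0 : 0 < lam j - m by lra.
  rewrite ler_wpM2l //; first by lra.
  by rewrite lef_pV2 ?posrE // lerB.
have L0 : 0 <= L.
  rewrite /L big_nat sumr_ge0 // => j /andP[rj]; rewrite ltnS => js.
  have := lams j; rewrite js andbT (leq_trans _ rj) // => /(_ isT); lra.
have main : lam r.+1 * L <= n * g ^+ 2 / (16 * C3 ^+ 2).
  have q0 : 0 <= L / g by rewrite divr_ge0 // ltW.
  have rr : 0 <= lam r.+1 / g by rewrite divr_ge0 //; lra.
  have := le_trans (ler_pM rr q0 ratio Lg) hyp.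
  have -> : lam r.+1 / g * (L / g) = lam r.+1 * L / g ^+ 2 by field; rewrite gt_eqF.
  by rewrite ler_pdivrMr ?exprn_gt0 // mulrAC.
have C0 : 0 < C3 by lra.
have lr0 : 0 < lam r.+1 by lra.
(* If the minimum is x, g <= lam_{r+1} and 8 C3 >= 1 suffice; if it is x^2, m <= lam_{r+1} and 4 <=
   16 do. *)
rewrite -/L minEle; case: ifP => _.
  have -> : n * m * x = n * g / (2 * C3) by rewrite xE /g; field; rewrite !gt_eqF.
  rewrite -(ler_pM2l lr0); apply: le_trans main _.
  have -> : lam r.+1 * (n * g / (2 * C3)) =
      n * (lam r.+1 * g) * (8 * C3) / (16 * C3 ^+ 2) by field; rewrite gt_eqF.
  apply: ler_wpM2r; first by rewrite invr_ge0 mulr_ge0 // sqr_ge0.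
  apply: (@le_trans _ _ (n * (lam r.+1 * g))).
    by rewrite ler_wpM2l // expr2 ler_wpM2r ?(ltW g0) // /g; lra.
  by apply: ler_peMr; [rewrite !mulr_ge0 // ltW|lra].
have -> : n * m * x ^+ 2 = n * g ^+ 2 / (4 * C3 ^+ 2) / m.
  by rewrite xE /g; field; rewrite !gt_eqF.
rewrite ler_pdivlMr // mulrC; apply: (@le_trans _ _ (lam r.+1 * L)).
  by rewrite ler_wpM2r //; lra.
apply: le_trans main _; apply: ler_wpM2l; first by rewrite mulr_ge0 ?sqr_ge0.
rewrite lef_pV2 ?posrE ?mulr_gt0 ?exprn_gt0 // ler_wpM2r ?sqr_ge0 //; lra.
Qed.

Theorem theorem2p12 (R : realType) (C1 C3 : R)
    (C3_gt1 : 1 < C3) (C3_KL : koltchinskii_lounici C1 C3) :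
  exists2 C : R, 0 < C &
  forall (H : separableHilbertType R) (p : option nat)
    (disp : measure_display) (T : measurableType disp) (P : probability T R)
    (X : T -> H) (Sigma : H -> H) (lam : nat -> R) (u : nat -> H)
    (n : nat) (Xs : 'I_n -> T -> H)
    (lamhat : T -> nat -> R) (uhat : T -> nat -> H) (d s : nat),
  random_vector X -> centered P X -> subgaussian P C1 X ->
  is_covariance P X Sigma ->
  eigendecomposition p Sigma lam u ->
  (forall j, in_dim p j -> 0 < lam j) ->
  (1 <= n)%N -> independent_copies P X Xs ->
  (forall w, eigendecomposition p (sample_covariance Xs w) (lamhat w) (uhat w)) ->
  (forall w j, in_dim p j -> 0 <= lamhat w j) ->
  (1 <= d)%N -> in_dim p d.+1 ->
  (forall x, random_vector (fun w => eigenprojection (uhat w) d x)) ->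
  (1 <= s <= d)%N ->
  lam d.+1 < lam s ->
  lam s / (lam s - lam d.+1)
    * (\sum_(1 <= j < s.+1) lam j / (lam j - lam d.+1))
  <= n%:R / (16 * C3 ^+ 2) ->
  (\int[P]_w reconstruction_error p u Sigma (eigenprojection (uhat w) d)
   <= C%:E * trace_gt p lam s
      + C%:E * trace p u Sigma
        * (expR (- (n%:R * (lam s - lam d.+1) ^+ 2
                    / (4 * C3 * lam s) ^+ 2)))%:E)%E.
Proof.
(* This is 2 (1 + 16 C1^4): the 2 pays for tr_{>r} <= 2 tr_{>s}, and C >= 2 also covers the two
   exceptional events. *)
pose C : R := 2 + 32 * C1 ^+ 4.
have C1_ge0 : 0 <= C1 ^+ 4 by rewrite exprn_even_ge0.
have C_gt0 : 0 < C by rewrite /C; lra.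
exists C => // H p disp T P X Sigma lam u n Xs lamhat uhat d s mX cX sX cS eS lam_gt0
  n_gt0 iX eSh _ d_gt0 pd mproj sd mu_lt hyp.
set E := expR _; have E_gt0 : 0 < E by exact: expR_gt0.
rewrite (trace_eigen eS).
have [onb _ dec] := eS; have /andP[s0 sd'] := sd.
have sS := covariance_self_adjoint cS.
have pd' : in_dim p d by apply: in_dim_le pd; rewrite d_gt0 leqnSn.
have pj j : (1 <= j <= d)%N -> in_dim p j by move=> h; exact: in_dim_le pd'.
have mu_gt0 : 0 < lam d.+1 by exact: lam_gt0.
have split r q : (r <= q <= d)%N -> trace_gt p lam r =
    ((\sum_(r.+1 <= j < q.+1) lam j)%:E + trace_gt p lam q)%E.
  move=> /andP[rq qd]; apply: trace_gt_split => //.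
  by case: q rq qd => [|q] _ qd; [rewrite orbT|rewrite pj].
have tr0 r := trace_gt_ge0 lam_gt0 r.
(* An infinite trace makes the right-hand side infinite, because the exponential is positive. *)
case tE : (trace_gt p lam 0) (tr0 0%N) => [t| |] // t0; last first.
  rewrite gt0_muley ?lte_fin // gt0_mulye ?lte_fin // addey ?leey //.
  by rewrite gt_eqF // (lt_le_trans (ltNyr 0)) // mule_ge0 // lee_fin ltW.
have fin r : (r <= d)%N -> exists2 tau, trace_gt p lam r = tau%:E & 0 <= tau.
  move=> rd; have := split 0%N r rd; rewrite tE; have := tr0 r.
  by case: (trace_gt p lam r) => // tau tau0 _; exists tau.
have [tau tauE tau0] := fin s sd'; have [taud taudE taud0] := fin d (leqnn d).
rewrite tauE -!EFinM -EFinD.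
pose x j := (lam j - lam d.+1) / (2 * C3 * lam d.+1).
pose good j := (trace_gt p lam d <= (n%:R * lam d.+1 * Num.min (x j) (x j ^+ 2))%:E)%E.
(* The value [r = 0] means that no index up to [s] satisfies the trace condition. *)
have [r [rs good_r bad]] := exists_last_index good s.
have rd : (r <= d)%N by exact: leq_trans sd'.
have [taur taurE taur0] := fin r rd.
have decs i j : (1 <= i <= j)%N -> (j <= s)%N -> lam j <= lam i.
  move=> /andP[i1 ij] js; apply: dec => //; apply: pj.
    by rewrite i1 (leq_trans ij) // (leq_trans js).
  by rewrite (leq_trans i1 ij) (leq_trans js).
have taur_le : taur <= 2 * tau.
  have := split r s; rewrite rs sd' => /(_ isT); rewrite taurE tauE -EFinD => -[->].
  have : \sum_(r.+1 <= j < s.+1) lam j <= tau; last by lra.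
  move: rs; rewrite leq_eqVlt => /predU1P[->|rs']; first by rewrite big_geq.
  apply: (@le_trans _ _ taud).
    have /negP : ~ good r.+1 by apply: bad; rewrite leqnn.
    rewrite /good taudE lee_fin -ltNge => /ltW; apply: le_trans.
    by apply: (block_sum_le decs) hyp _.
  have := split s d; rewrite sd' leqnn => /(_ isT); rewrite tauE taudE -EFinD => -[->].
  rewrite lerDr big_nat sumr_ge0 // => j; rewrite ltnS => /andP[sj jd].
  by rewrite ltW // lam_gt0 // pj // jd (leq_ltn_trans _ sj).
have onbh w : orthonormal_basis p (uhat w) by case: (eSh w).
(* For [r = 0] the full trace is itself at most 2 tr_{>s}, so the trivial bound on the error is
   enough. *)
have [r0|r_gt0] := posnP r.
  apply: (@le_trans _ _ (\int[P]_w taur%:E)%E).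
    apply: ge0_le_integral => //.
    - by move=> w _; exact: (reconstruction_error_ge0 eS sS lam_gt0 (onbh w)).
    - exact: (measurable_reconstruction_error eS).
    - move=> w _; rewrite -taurE r0.
      exact: (reconstruction_error_le_trace eS sS lam_gt0 (onbh w)).
  rewrite integral_cst //= probability_setT mule1 lee_fin.
  apply: (le_trans taur_le); rewrite -[leLHS]addr0; apply: lerD.
    by rewrite ler_wpM2r // /C; lra.
  by rewrite !mulr_ge0 // ltW.
have rd' : (1 <= r <= d)%N by rewrite r_gt0.
have lrs : lam s <= lam r by apply: decs; rewrite ?r_gt0.
have gap_r : 0 < lam r - lam d.+1 by lra.
have ratio : lam r / (lam r - lam d.+1) <= lam s / (lam s - lam d.+1).
  exact: ratio_gap_le.
have term0 j : (1 <= j <= s)%N -> 0 <= lam j / (lam j - lam d.+1).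
  by move=> /andP[j1 js]; have := decs j s; rewrite j1 js leqnn => /(_ isT isT) h;
     rewrite divr_ge0 //; lra.
(* The condition on [s] passes to [r]: the ratio lam / gap is smaller at [r] and the sum has fewer
   nonnegative terms. *)
apply: le_trans (expected_reconstruction_error_le C3_gt1 C3_KL mX cX sX cS eS lam_gt0
  n_gt0 iX eSh pd rd' mproj gap_r taurE erefl (good_r r_gt0) _ tE) _.
  apply: le_trans hyp; apply: ler_pM => //.
  - by rewrite term0 // r_gt0.
  - rewrite big_nat sumr_ge0 // => j; rewrite ltnS => /andP[j1 jr].
    by rewrite term0 // j1 (leq_trans jr).
  - rewrite [leRHS](@big_cat_nat _ _ _ r.+1) //= lerDl big_nat sumr_ge0 // => j.
    rewrite ltnS => /andP[rj js]; rewrite term0 // js andbT.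
    exact: leq_ltn_trans rj.
(* The relative gap at [r] is at least the one at [s], so the exponential at [r] is the smaller
   one. *)
set Er := expR _; have Er_le : Er <= E.
  have C3_gt0 : 0 < C3 by lra.
  have lr_gt0 : 0 < lam r by lra.
  have ls_gt0 : 0 < lam s by lra.
  have gs_gt0 : 0 < lam s - lam d.+1 by lra.
  have scale a b : 0 < b -> n%:R * a ^+ 2 / (4 * C3 * b) ^+ 2 =
      n%:R * (a / b / (4 * C3)) ^+ 2 by move=> b0; field; rewrite !gt_eqF.
  rewrite ler_expR lerN2 !scale // ler_wpM2l //.
  apply: lerXn2r; rewrite ?nnegrE ?divr_ge0 ?mulr_ge0 // ?(ltW gs_gt0) ?(ltW gap_r)
    ?(ltW lr_gt0) ?(ltW ls_gt0) ?(ltW C3_gt0) //.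
  rewrite ler_pM2r ?invr_gt0 ?mulr_gt0 // -[leLHS]invf_div -[leRHS]invf_div.
  by rewrite lef_pV2 ?posrE ?divr_gt0.
rewrite lee_fin; apply: lerD.
  apply: (@le_trans _ _ ((1 + 16 * C1 ^+ 4) * (2 * tau))).
    by rewrite ler_wpM2l //; lra.
  by rewrite /C mulrA ler_wpM2r //; lra.
apply: ler_pM => //; first by rewrite mulr_ge0.
  by rewrite ltW // expR_gt0.
by rewrite ler_wpM2r // /C; lra.
Qed.
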